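(* Let $(\mathcal{A},\varphi)$ be a von Neumann algebra with faithful tracial state $\varphi$, let $a,b\in\mathcal{A}$ be $*$-free, and let $s,t\in\mathbf{C}$ with $|s|<\frac1{\rho(a)}$ and $|t|<\frac1{\rho(b)}$. Put $$f(s)=\varphi((1-sa)^{-1}),\qquad g(t)=\varphi((1-tb)^{-1}),$$ $$\overset{\circ}{a}(s)=(1-sa)^{-1}-f(s),\qquad \overset{\circ}{b}(t)=(1-tb)^{-1}-g(t),$$ and assume that $sf(s)=tg(t)\neq0$. Set $$\lambda=\frac{f(s)+g(t)-1}{sf(s)}=\frac1s+\frac1t-\frac1{sf(s)}.$$ Then: (i) $$\lambda-a-b=\frac{g(t)}{s}\,(1-sa)\left(1-\frac{\overset{\circ}{a}(s)\,\overset{\circ}{b}(t)}{f(s)\,g(t)}\right)(1-tb).$$ (ii) If $\|\overset{\circ}{a}(s)\|_2^2\,\|\overset{\circ}{b}(t)\|_2^2<|f(s)|^2\,|g(t)|^2$, then $\lambda\in\mathbf{C}\setminus\sigma(a+b)$. (iii) If $\|\overset{\circ}{a}(s)\|_2^2\,\|\overset{\circ}{b}(t)\|_2^2=|f(s)|^2\,|g(t)|^2$, then $\lambda\in\sigma(a+b)$.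
   Context: $\rho(x)$ denotes the spectral radius and $\sigma(x)$ the spectrum of $x\in\mathcal{A}$ (with $1/\rho(x)=\infty$ if $\rho(x)=0$); $\|x\|_2=\varphi(x^*x)^{1/2}$; scalars are identified with multiples of the unit. Unital subalgebras $\mathcal{A}_1,\mathcal{A}_2\subseteq\mathcal{A}$ are free if $\varphi(a_1\cdots a_n)=0$ whenever $a_j\in\mathcal{A}_{i_j}$, $\varphi(a_j)=0$, and $i_j\ne i_{j+1}$ for $j=1,\dots,n-1$. Elements $a,b$ are $*$-free if the von Neumann subalgebras they generate (with the unit) are free. The state $\varphi$ is taken to be normal, as usual for a von Neumann probability space. *)

(* Defs.v *)
From HB Require Import structures.
From mathcomp Require Import all_boot all_order all_algebra.
From mathcomp Require Import all_classical all_reals all_analysis.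
From mathcomp Require Import complex.

Set Implicit Arguments.
Unset Strict Implicit.
Unset Printing Implicit Defensive.

Import Order.TTheory GRing.Theory Num.Theory.
Import numFieldNormedType.Exports.

Local Open Scope classical_set_scope.
Local Open Scope ring_scope.

(* Complex Hilbert spaces. The inner product is linear in its first argument.
   The space is required to be nonzero, so that its bounded operators form a
   nontrivial ring; nothing is lost, as operators on the zero space carry no
   state. *)
HB.mixin Record CompleteNormedModule_isHilbert (R : realType) H
    of CompleteNormedModule R[i] H := {
  hdot : {dot H for (@Num.conj R[i])} ;
  hdot_norm : forall u : H, `|u| ^+ 2 = hdot u u ;
  hilbert_neq0 : exists u : H, u != 0 }.

#[short(type="hilbertType")]
HB.structure Definition Hilbert (R : realType) :=
  {H of CompleteNormedModule R[i] H & CompleteNormedModule_isHilbert R H}.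

Section BoundedOperators.
Context {R : realType} (H : hilbertType R).

Definition is_bounded_operator : {pred H -> H} := fun f =>
  `[< (forall (c : R[i]) u v, f (c *: u + v) = c *: f u + f v) /\
      (exists M : R[i], forall u, `|f u| <= M * `|u|) >].

Record bounded_operator := BoundedOperator {
  opval :> H -> H ;
  opvalP : opval \in is_bounded_operator }.

HB.instance Definition _ := [isSub for opval].
HB.instance Definition _ := [Choice of bounded_operator by <:].

Lemma bounded_operatorP (f : bounded_operator) :
  (forall (c : R[i]) u v, f (c *: u + v) = c *: f u + f v) /\
  exists2 M : R[i], 0 <= M & forall u, `|f u| <= M * `|u|.
Proof.
have /asboolP[fl [M fM]] := opvalP f; split=> //; exists M => //.
have [u u0] := @hilbert_neq0 R H.
by rewrite -(pmulr_lge0 _ (x := `|u|)) ?normr_gt0 // (le_trans _ (fM u)).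
Qed.

Lemma is_bounded_operator_submod : submod_closed is_bounded_operator.
Proof.
split.
  apply/asboolP; split=> [c u v|]; first by rewrite scaler0 addr0.
  by exists 0 => u; rewrite normr0 mul0r.
move=> a f g fB gB; have := bounded_operatorP (BoundedOperator fB).
have := bounded_operatorP (BoundedOperator gB) => /= -[gl [N N0 gN]].
move=> -[fl [M M0 fM]]; apply/asboolP; split=> [c u v|].
  have -> w : (a *: f + g) w = a *: f w + g w by [].
  by rewrite fl gl !scalerDr !scalerA (mulrC a) addrACA.
exists (`|a| * M + N) => u; rewrite mulrDl.
apply: (le_trans (ler_normD _ _)); apply: lerD => //.
by rewrite normrZ -mulrA ler_wpM2l.
Qed.

HB.instance Definition _ :=
  GRing.isSubmodClosed.Build _ _ is_bounded_operator is_bounded_operator_submod.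
HB.instance Definition _ := [SubChoice_isSubLmodule of bounded_operator by <:].

Lemma bounded_operator_id : idfun \in is_bounded_operator.
Proof. by apply/asboolP; split=> //; exists 1 => u; rewrite mul1r. Qed.

Lemma bounded_operator_comp (f g : bounded_operator) :
  (f : H -> H) \o g \in is_bounded_operator.
Proof.
have [fl [M M0 fM]] := bounded_operatorP f.
have [gl [N N0 gN]] := bounded_operatorP g.
apply/asboolP; split=> [c u v|]; first by rewrite /= gl fl.
by exists (M * N) => u /=; rewrite (le_trans (fM _)) // -mulrA ler_wpM2l.
Qed.

Definition op_one := BoundedOperator bounded_operator_id.
Definition op_mul (f g : bounded_operator) :=
  BoundedOperator (bounded_operator_comp f g).

Lemma op_ext (f g : bounded_operator) : (forall u, f u = g u) -> f = g.
Proof. by move=> fg; apply/val_inj/funext. Qed.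

Lemma op_mulA : associative op_mul.
Proof. by move=> f g h; apply: op_ext. Qed.

Lemma op_mul1 : left_id op_one op_mul.
Proof. by move=> f; apply: op_ext. Qed.

Lemma op_mulr1 : right_id op_one op_mul.
Proof. by move=> f; apply: op_ext. Qed.

Lemma op_mulDl : left_distributive op_mul +%R.
Proof. by move=> f g h; apply: op_ext. Qed.

Lemma op_mulDr : right_distributive op_mul +%R.
Proof.
move=> f g h; apply: op_ext => u /=.
have [fl _] := bounded_operatorP f.
by rewrite -[X in X + _]scale1r fl scale1r.
Qed.

Lemma op_one_neq0 : op_one != 0.
Proof.
have [u u0] := @hilbert_neq0 R H.
by apply/eqP => /(congr1 (fun f : bounded_operator => f u)) /eqP; apply/negP.
Qed.

HB.instance Definition _ := GRing.Zmodule_isNzRing.Build bounded_operator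
  op_mulA op_mul1 op_mulr1 op_mulDl op_mulDr op_one_neq0.

Lemma op_scaleAl (c : R[i]) (f g : bounded_operator) :
  c *: (f * g) = (c *: f) * g.
Proof. by apply: op_ext. Qed.

HB.instance Definition _ :=
  GRing.Lmodule_isLalgebra.Build R[i] bounded_operator op_scaleAl.

Lemma op_scaleAr (c : R[i]) (f g : bounded_operator) :
  c *: (f * g) = f * (c *: g).
Proof.
apply: op_ext => u; have [fl _] := bounded_operatorP f.
have f0 : f 0 = 0.
  by have := fl (-1) 0 0; rewrite scaler0 addr0 scaleN1r addNr.
rewrite /= [RHS](_ : _ = f (c *: g u + 0)); first by rewrite fl f0 addr0.
by rewrite addr0.
Qed.

HB.instance Definition _ :=
  GRing.Lalgebra_isAlgebra.Build R[i] bounded_operator op_scaleAr.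

Definition op_unit : {pred bounded_operator} := fun f =>
  `[< exists g, g * f = 1 /\ f * g = 1 >].

Definition op_inv (f : bounded_operator) : bounded_operator :=
  xget f [set g | g * f = 1 /\ f * g = 1].

Lemma op_invP f : f \in op_unit -> op_inv f * f = 1 /\ f * op_inv f = 1.
Proof. by move=> /asboolP[g gf]; rewrite /op_inv; case: xgetP => [h _|/(_ g)]. Qed.

Lemma op_mulVr : {in op_unit, left_inverse 1 op_inv *%R}.
Proof. by move=> f /op_invP[]. Qed.

Lemma op_divrr : {in op_unit, right_inverse 1 op_inv *%R}.
Proof. by move=> f /op_invP[]. Qed.

Lemma op_unitrP f g : g * f = 1 /\ f * g = 1 -> f \in op_unit.
Proof. by move=> fg; apply/asboolP; exists g. Qed.

Lemma op_invr_out : {in [predC op_unit], op_inv =1 id}.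
Proof.
move=> f; rewrite inE => /negP fU; rewrite /op_inv; case: xgetP => // g _ gf.
by case: fU; apply: op_unitrP gf.
Qed.

HB.instance Definition _ := GRing.NzRing_hasMulInverse.Build bounded_operator
  op_mulVr op_divrr op_unitrP op_invr_out.

End BoundedOperators.

Notation "''B' ( H )" := (bounded_operator H)
  (at level 8, format "''B' ( H )") : type_scope.

Section VonNeumann.
Context {R : realType} {H : hilbertType R}.
Implicit Types (x y : 'B(H)) (M A : set 'B(H)) (phi : 'B(H) -> R[i]).

Definition is_adjoint x y := forall u v : H, hdot (x u) v = hdot u (y v).

(* The adjoint of x; it exists by the Riesz representation theorem and is
   unique, so the default value is never used. *)
Definition adj x : 'B(H) := xget 0 [set y | is_adjoint x y].

Definition commutant M : set 'B(H) := [set y | forall x, M x -> x * y = y * x].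

(* A von Neumann algebra acting on H: a self-adjoint set of operators equal to
   its double commutant (in particular a unital subalgebra of 'B(H)). *)
Definition von_neumann_algebra M : Prop :=
  (forall x, M x -> exists2 y, is_adjoint x y & M y) /\
  commutant (commutant M) = M.

Definition vn_generated x : set 'B(H) :=
  \bigcap_(N in [set N | von_neumann_algebra N /\ N x]) N.

Definition op_le x y : Prop := forall u : H, 0 <= hdot ((y - x) u) u.

(* A normal state preserves least upper bounds of increasing nets of
   self-adjoint elements, here given by their (upward directed) ranges. *)
Definition normal_on M phi : Prop :=
  forall (D : set 'B(H)) x,
    D !=set0 -> D `<=` M -> (forall d, D d -> is_adjoint d d) ->
    (forall d e, D d -> D e -> exists2 c, D c & op_le d c /\ op_le e c) ->
    M x -> (forall d, D d -> op_le d x) ->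
    (forall y, M y -> (forall d, D d -> op_le d y) -> op_le x y) ->
    (forall d, D d -> phi d <= phi x) /\
    (forall c, (forall d, D d -> phi d <= c) -> phi x <= c).

Record faithful_normal_tracial_state M phi : Prop := {
  state_linear : forall (c : R[i]) x y, M x -> M y ->
    phi (c *: x + y) = c * phi x + phi y ;
  state_pos : forall x, M x -> 0 <= phi (adj x * x) ;
  state_one : phi 1 = 1 ;
  state_tracial : forall x y, M x -> M y -> phi (x * y) = phi (y * x) ;
  state_faithful : forall x, M x -> phi (adj x * x) = 0 -> x = 0 ;
  state_normal : normal_on M phi }.

Definition norm2 phi x : R[i] := sqrtC (phi (adj x * x)).

Definition free_subalgebras phi (A1 A2 : set 'B(H)) : Prop :=
  forall (n : nat) (i : nat -> bool) (x : nat -> 'B(H)),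
    (0 < n)%N ->
    (forall j, (j < n)%N -> (if i j then A1 else A2) (x j)) ->
    (forall j, (j < n)%N -> phi (x j) = 0) ->
    (forall j, (j.+1 < n)%N -> i j != i j.+1) ->
    phi (\prod_(0 <= j < n) x j) = 0.

Definition star_free phi x y : Prop :=
  free_subalgebras phi (vn_generated x) (vn_generated y).

Definition spectrum M x : set R[i] :=
  [set z | ~ exists2 y, M y & y * (z%:A - x) = 1 /\ (z%:A - x) * y = 1].

Definition spectral_radius M x : \bar R :=
  ereal_sup [set (Normc.normc z)%:E | z in spectrum M x].

End VonNeumann.

(* Main.v *)
(** With [X = 1 - s a] and [Y = 1 - t b], part (i) is the expansion of
    [X (1 - (X^-1 - f) (Y^-1 - g) / (f g)) Y]. It reduces (ii) and (iii) to the
    invertibility of [1 - x y] for centered elements [x], [y] of two free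
    subalgebras, with [k := |x|_2 |y|_2].

    By freeness the span of the reduced words is the orthogonal sum of [K], the
    span of the words that do not start in the factor of [y], and [L], the span
    of those that do. Left multiplication by [x y] maps [K] to itself and
    multiplies 2-norms by [k] there, and the adjoint of its compression to [L]
    is the restriction of [y^* x^*], which multiplies 2-norms by [k] too. So if
    [k < 1], then [1 - x y] is block triangular with diagonal blocks bounded
    below, hence is bounded below in 2-norm on the algebra generated by the two
    factors; the same holds for its adjoint. Since the state is faithful, a lower
    bound in 2-norm is a lower bound in the Hilbert space (test it on the
    positive part of [d^2 - h] for [h] the modulus squared), and an operator that
    is bounded below together with its adjoint is invertible.

    If [k = 1], then by orthogonality [1 + T + ... + T^(n-1)], where [T = x y],
    has 2-norm [sqrt n], while its product with [1 - T] has 2-norm at most 2; so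
    [1 - T] is not invertible. *)

Require Import Defs.
From HB Require Import structures.
From mathcomp Require Import all_boot all_order all_algebra.
From mathcomp Require Import all_classical all_reals all_analysis.
From mathcomp Require Import complex.
From mathcomp Require Import ring lra.

Set Implicit Arguments.
Unset Strict Implicit.
Unset Printing Implicit Defensive.

Import Order.TTheory GRing.Theory Num.Theory.
Import numFieldNormedType.Exports.

Local Open Scope classical_set_scope.
Local Open Scope ring_scope.

Local Notation normc := Normc.normc.
Local Notation "x %:C" := (real_complex _ x) : ring_scope.

(** * Moduli and real parts of complex numbers *)

Section ComplexReal.
Context {R : realType}.
Implicit Types (z w : R[i]) (x y : R).

Lemma normrC z : `|z| = (normc z)%:C.
Proof. by case: z. Qed.

Lemma normc_ge0 z : 0 <= normc z.
Proof. by case: z => a b; apply: sqrtr_ge0. Qed.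

Lemma normc_gt0 z : (0 < normc z) = (z != 0).
Proof. by rewrite -normr_gt0 normrC ltcR. Qed.

Lemma normc_real x : normc x%:C = `|x|.
Proof. by rewrite /= expr0n addr0 sqrtr_sqr. Qed.

Lemma mul_conjC_normc z : z * z^* = (normc z ^+ 2)%:C.
Proof. by rewrite -normCK normrC rmorphXn. Qed.

Lemma conjC_real x : (x%:C)^* = x%:C.
Proof. by apply/eqP; rewrite -CrealE complex_real. Qed.

Lemma ge0_complexP z : 0 <= z -> exists2 x, 0 <= x & z = x%:C.
Proof. by case: z => x y; rewrite lecE /= => /andP[/eqP -> x0]; exists x. Qed.

Lemma Re_le_normc z : complex.Re z <= normc z.
Proof.
case: z => a b /=; apply: le_trans (ler_norm a) _.
by rewrite -sqrtr_sqr ler_sqrt ?addr_ge0 ?sqr_ge0 // lerDl sqr_ge0.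
Qed.

End ComplexReal.

(** * Semi-inner products *)

Section SemiInnerProduct.
Context {R : realType} {V : lmodType R[i]}.

(** The form is constrained only on a domain [S], because a state is linear only on its algebra. One
    theory then serves [hdot], the form of a positive operator and the form of a state. *)
Record semi_inner (S : set V) (F : V -> V -> R[i]) : Prop := SemiInner {
  semi_inner_dom : forall c u v, S u -> S v -> S (c *: u + v) ;
  semi_inner_lin : forall c u v w, S u -> S v -> S w ->
    F (c *: u + v) w = c * F u w + F v w ;
  semi_inner_conj : forall u v, S u -> S v -> F u v = (F v u)^* ;
  semi_inner_pos : forall u, S u -> 0 <= F u u }.

Definition snorm (F : V -> V -> R[i]) u : R := Num.sqrt (complex.Re (F u u)).

Context {S : set V} {F : V -> V -> R[i]} (SF : semi_inner S F).
Implicit Types (u v w : V) (c : R[i]).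

Lemma semi_inner_dom0 u : S u -> S 0.
Proof. by move=> Su; rewrite -(addNr u) -scaleN1r; exact: (semi_inner_dom SF). Qed.

Lemma semi_inner_domD u v : S u -> S v -> S (u + v).
Proof. by move=> Su Sv; rewrite -[u]scale1r; exact: (semi_inner_dom SF). Qed.

Lemma semi_inner_domZ c u : S u -> S (c *: u).
Proof.
move=> Su; rewrite -[_ *: _]addr0; apply: (semi_inner_dom SF) => //.
exact: semi_inner_dom0 Su.
Qed.

Lemma semi_innerDl u v w : S u -> S v -> S w -> F (u + v) w = F u w + F v w.
Proof.
by move=> Su Sv Sw; rewrite -[u in LHS]scale1r (semi_inner_lin SF) // mul1r.
Qed.

Lemma semi_inner0l u : S u -> F 0 u = 0.
Proof.
move=> Su; have S0 := semi_inner_dom0 Su.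
by apply: (addrI (F 0 u)); rewrite -semi_innerDl // !addr0.
Qed.

Lemma semi_innerZl c u v : S u -> S v -> F (c *: u) v = c * F u v.
Proof.
move=> Su Sv; have S0 := semi_inner_dom0 Su.
by rewrite -[_ *: _]addr0 (semi_inner_lin SF) // semi_inner0l // addr0.
Qed.

Lemma semi_innerDr u v w : S u -> S v -> S w -> F w (u + v) = F w u + F w v.
Proof.
move=> Su Sv Sw; rewrite (semi_inner_conj SF) //; last exact: semi_inner_domD.
by rewrite semi_innerDl // rmorphD /= -!(semi_inner_conj SF).
Qed.

Lemma semi_innerZr c u v : S u -> S v -> F u (c *: v) = c^* * F u v.
Proof.
move=> Su Sv; rewrite (semi_inner_conj SF) //; last exact: semi_inner_domZ.
by rewrite semi_innerZl // rmorphM /= -(semi_inner_conj SF).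
Qed.

Lemma snorm_ge0 u : 0 <= snorm F u.
Proof. exact: sqrtr_ge0. Qed.

Lemma snorm_sqr u : S u -> F u u = (snorm F u ^+ 2)%:C.
Proof.
move=> /(semi_inner_pos SF)/ge0_complexP[x x0 Fu].
by rewrite /snorm Fu /= sqr_sqrtr.
Qed.

Lemma snormDsqr u v : S u -> S v ->
  (snorm F (u + v) ^+ 2)%:C =
  (snorm F u ^+ 2)%:C + (snorm F v ^+ 2)%:C + (F u v + (F u v)^*).
Proof.
move=> Su Sv; have Suv := semi_inner_domD Su Sv.
rewrite -!snorm_sqr // semi_innerDl // !semi_innerDr //.
rewrite -(semi_inner_conj SF) //; ring.
Qed.

Lemma snormZ c u : S u -> snorm F (c *: u) = normc c * snorm F u.
Proof.
move=> Su; apply/eqP; rewrite -(eqrXn2 (n := 2)) ?mulr_ge0 ?normc_ge0 ?snorm_ge0 //.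
apply/eqP/complexI; rewrite -snorm_sqr; last exact: semi_inner_domZ.
rewrite semi_innerZl ?semi_innerZr //; last exact: semi_inner_domZ.
by rewrite exprMn rmorphM /= -snorm_sqr // -mul_conjC_normc mulrA.
Qed.

Lemma snormN u : S u -> snorm F (- u) = snorm F u.
Proof.
move=> Su; rewrite -scaleN1r snormZ // -(rmorphN1 (real_complex R)) normc_real.
by rewrite normrN1 mul1r.
Qed.

Lemma semi_inner_CS u v : S u -> S v -> normc (F u v) <= snorm F u * snorm F v.
Proof.
move=> Su Sv; set B := normc _.
have B0 : 0 <= B by apply: normc_ge0.
(* This is [|u - t F(u,v) v|^2 >= 0], a real quadratic in [t]. *)
have H t : 0 <= snorm F u ^+ 2 - 2 * t * B ^+ 2 + t ^+ 2 * B ^+ 2 * snorm F v ^+ 2.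
  pose z : R[i] := (- t)%:C * F u v.
  have Szv : S (z *: v) by apply: semi_inner_domZ.
  suff -> : snorm F u ^+ 2 - 2 * t * B ^+ 2 + t ^+ 2 * B ^+ 2 * snorm F v ^+ 2
    = snorm F (u + z *: v) ^+ 2 by apply: sqr_ge0.
  apply: complexI; rewrite snormDsqr // semi_innerZr // snormZ // Normc.normcM normc_real.
  have -> : z^* * F u v = (- t * B ^+ 2)%:C.
    rewrite /z rmorphM /= conjC_real -mulrA [_^* * _]mulrC mul_conjC_normc.
    by rewrite -rmorphM.
  rewrite conjC_real normrN -/B !exprMn real_normK ?num_real //.
  by rewrite -!rmorphD /=; congr (_%:C); ring.
(* The form may be degenerate. If [v] has norm 0, the quadratic is affine in [t], and the [t] below
   would make it equal to -1 unless [B = 0]. *)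
have [v0|v0] := eqVneq (snorm F v ^+ 2) 0.
  have -> : B = 0; last by rewrite mulr_ge0 ?snorm_ge0.
  apply/eqP; rewrite -sqrf_eq0; apply/contraT => Bn0.
  have Bp : 0 < B ^+ 2 by rewrite lt0r Bn0 sqr_ge0.
  have := H ((snorm F u ^+ 2 + 1) / (2 * B ^+ 2)).
  rewrite v0 mulr0 addr0.
  have -> : 2 * ((snorm F u ^+ 2 + 1) / (2 * B ^+ 2)) * B ^+ 2 = snorm F u ^+ 2 + 1.
    by field; rewrite -sqrf_eq0.
  lra.
have vp : 0 < snorm F v ^+ 2 by rewrite lt0r v0 sqr_ge0.
rewrite -(ler_pXn2r (n := 2)) ?nnegrE ?mulr_ge0 ?snorm_ge0 //.
(* The minimum of the quadratic is at [t = 1 / |v|^2]. *)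
have := H (snorm F v ^+ 2)^-1; rewrite exprMn -ler_pdivrMr //.
set X := snorm F v ^+ 2 in vp v0 *.
have -> : snorm F u ^+ 2 - 2 * X^-1 * B ^+ 2 + X^-1 ^+ 2 * B ^+ 2 * X
  = snorm F u ^+ 2 - B ^+ 2 / X by field.
by rewrite subr_ge0.
Qed.

Lemma snormD u v : S u -> S v -> snorm F (u + v) <= snorm F u + snorm F v.
Proof.
move=> Su Sv; rewrite -(ler_pXn2r (n := 2)) ?nnegrE ?addr_ge0 ?snorm_ge0 //.
have := semi_inner_CS Su Sv; have := Re_le_normc (F u v).
have /(congr1 (@complex.Re R)) := snormDsqr Su Sv.
by case: (F u v) => a b /= -> H1 H2; rewrite sqrrD; lra.
Qed.

Lemma snormB u v : S u -> S v -> snorm F u - snorm F v <= snorm F (u - v).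
Proof.
move=> Su Sv; rewrite lerBlDr -{1}[u](subrK v) snormD //.
by apply: semi_inner_domD => //; rewrite -scaleN1r; apply: semi_inner_domZ.
Qed.

Lemma snorm_pythagoras u v : S u -> S v -> F u v = 0 ->
  snorm F (u + v) ^+ 2 = snorm F u ^+ 2 + snorm F v ^+ 2.
Proof.
move=> Su Sv uv0; apply: complexI.
by rewrite snormDsqr // uv0 rmorph0 !addr0 rmorphD.
Qed.

End SemiInnerProduct.

(** * Bounded operators on a Hilbert space *)

Section HilbertOperators.
Context {R : realType} {H : hilbertType R}.
Implicit Types (u v : H) (x y z g h : 'B(H)) (c : R[i]) (M N r e : R).

Local Notation hnorm := (snorm (@hdot R H)).

Lemma hdot_semi_inner : semi_inner setT (@hdot R H).
Proof.
split=> //.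
- by move=> c u v w _ _ _; rewrite linearDl /= linearZl_LR.
- by move=> u v _ _; rewrite hermC /= expr0 mul1r.

Qed.

Let hdotT := hdot_semi_inner.

Lemma hnormE u : `|u| = (hnorm u)%:C.
Proof.
apply/eqP; rewrite -(eqrXn2 (n := 2)) ?normr_ge0 ?ler0c ?snorm_ge0 //.
by rewrite hdot_norm (snorm_sqr hdotT) // rmorphXn.
Qed.

Lemma hnorm_ge0 u : 0 <= hnorm u. Proof. exact: snorm_ge0. Qed.

Lemma hnorm0_eq0 u : hnorm u = 0 -> u = 0.
Proof. by move=> u0; apply/eqP; rewrite -normr_eq0 hnormE u0 rmorph0. Qed.

Lemma hnorm0 : hnorm (0 : H) = 0.
Proof. by apply: complexI; rewrite -hnormE normr0. Qed.

Lemma hnormD u v : hnorm (u + v) <= hnorm u + hnorm v.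
Proof. exact: (snormD hdotT). Qed.

Lemma hnormN u : hnorm (- u) = hnorm u.
Proof. exact: (snormN hdotT). Qed.

Lemma hnormZ c u : hnorm (c *: u) = normc c * hnorm u.
Proof. exact: (snormZ hdotT). Qed.

Lemma hdot_CS u v : normc (hdot u v) <= hnorm u * hnorm v.
Proof. exact: (semi_inner_CS hdotT). Qed.

Lemma hnorm_distD u v w : hnorm (u - v) <= hnorm (u - w) + hnorm (w - v).
Proof. by rewrite -[u - v](_ : u - w + (w - v) = _) ?hnormD // addrA subrK. Qed.

Lemma hnorm_unit : exists u : H, 0 < hnorm u.
Proof.
have [u u0] := @hilbert_neq0 R H; exists u.
by rewrite lt0r hnorm_ge0 andbT; apply: contra u0 => /eqP/hnorm0_eq0 ->.
Qed.

Lemma hdot_eq0 u : hdot u u = 0 -> u = 0.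
Proof. by move=> u0; apply/eqP; rewrite -(dnorm_eq0 (@hdot R H)) u0. Qed.

Lemma opP x c u v : x (c *: u + v) = c *: x u + x v.
Proof. by have [] := bounded_operatorP x. Qed.

Lemma op_subE x y u : (x - y) u = x u - y u. Proof. by []. Qed.
Lemma op_addE x y u : (x + y) u = x u + y u. Proof. by []. Qed.
Lemma op_scaleE c x u : (c *: x) u = c *: x u. Proof. by []. Qed.
Lemma op_mulE x y u : (x * y) u = x (y u). Proof. by []. Qed.
Lemma op_oneE u : (1 : 'B(H)) u = u. Proof. by []. Qed.
Lemma op_zeroE u : (0 : 'B(H)) u = 0. Proof. by []. Qed.

Definition op_bound x M := forall u, hnorm (x u) <= M * hnorm u.

Lemma op_bound_ge0 x M : op_bound x M -> 0 <= M.
Proof.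
move=> xM; have [u u0] := hnorm_unit.
by rewrite -(pmulr_lge0 _ u0); apply: le_trans (xM u); apply: hnorm_ge0.
Qed.

Lemma op_bound_exists x : exists2 M, 0 < M & op_bound x M.
Proof.
have [_ [M /ge0_complexP[N N0 ->] xN]] := bounded_operatorP x.
exists (N + 1); first by rewrite ltr_wpDl.
move=> u; have := xN u; rewrite !hnormE -rmorphM lecR => /le_trans; apply.
by rewrite ler_wpM2r ?hnorm_ge0 // lerDl.
Qed.

Lemma op_bound_le x M N : op_bound x M -> M <= N -> op_bound x N.
Proof. by move=> xM MN u; apply: le_trans (xM u) _; rewrite ler_wpM2r ?hnorm_ge0. Qed.

Lemma op_boundD x y M N : op_bound x M -> op_bound y N -> op_bound (x + y) (M + N).
Proof.
move=> xM yN u; rewrite mulrDl op_addE (le_trans (hnormD _ _)) //.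
by rewrite lerD.
Qed.

Lemma op_boundM x y M N : op_bound x M -> op_bound y N -> op_bound (x * y) (M * N).
Proof.
move=> xM yN u; rewrite -mulrA (le_trans (xM _)) //.
by rewrite ler_wpM2l ?yN // (op_bound_ge0 xM).
Qed.

Lemma op_boundZ c x M : op_bound x M -> op_bound (c *: x) (normc c * M).
Proof. by move=> xM u; rewrite op_scaleE hnormZ -mulrA ler_wpM2l ?normc_ge0. Qed.

Lemma op_boundN x M : op_bound x M -> op_bound (- x) M.
Proof. by move=> xM u; rewrite [(- x) u](_ : _ = - x u) ?hnormN. Qed.

Lemma op_boundB x y M N : op_bound x M -> op_bound y N -> op_bound (x - y) (M + N).
Proof. by move=> xM /op_boundN; apply: op_boundD. Qed.

Lemma op_bound1 : op_bound 1 1.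
Proof. by move=> u; rewrite mul1r. Qed.

Lemma op_bound0 : op_bound 0 0.
Proof. by move=> u; rewrite op_zeroE hnorm0 mul0r. Qed.

Lemma op_bound_eq0 x : (forall e, 0 < e -> op_bound x e) -> x = 0.
Proof.
move=> xe; apply: op_ext => u; rewrite op_zeroE; apply/hnorm0_eq0/eqP.
rewrite eq_le hnorm_ge0 andbT; apply/ler_addgt0Pl => e e0; rewrite addr0.
(* The added 1 keeps the denominator positive even for [u = 0]. *)
have u1 : 0 < hnorm u + 1 by rewrite ltr_wpDl ?hnorm_ge0.
apply: le_trans (xe (e / (hnorm u + 1)) _ u) _; first exact: divr_gt0.
by rewrite mulrAC ler_pdivrMr // ler_wpM2l ?(ltW e0) // lerDl.
Qed.

(** Completeness in quantitative form: the limit inherits the Cauchy rate [e], so later limit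
    arguments are plain estimates. *)
Lemma hilbert_lim (p : nat -> H) (e : nat -> R) :
    (forall m n, (n <= m)%N -> hnorm (p m - p n) <= e n) ->
    (forall d, 0 < d -> exists n, e n <= d) ->
  exists l, forall n, hnorm (l - p n) <= e n.
Proof.
move=> pe e0.
have : cauchy_ex (p @ \oo).
  move=> d d0; have [r r0 dr] := ge0_complexP (ltW d0).
  have rp : 0 < r by rewrite lt0r r0 andbT; apply: contraTneq d0 => r00; rewrite dr r00 ltxx.
  have [n en] := e0 (r / 2) (divr_gt0 rp (ltr0Sn _ 1)).
  exists (p n); exists n => // m /= nm; rewrite -ball_normE /= distrC hnormE dr ltcR.
  apply: le_lt_trans (pe _ _ nm) _; apply: le_lt_trans en _; lra.
move=> /cauchy_exP/cauchy_cvg pc; exists (lim (p @ \oo)) => n.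
apply/ler_addgt0Pl => d d0.
have : \forall m \near \oo, `|lim (p @ \oo) - p m| < d%:C.
  by move/cvgr_dist_lt: pc; apply; rewrite ltcR.
move=> [N _ HN]; have := HN (maxn N n) (leq_maxl _ _); rewrite hnormE ltcR => lN.
by apply: le_trans (hnorm_distD _ _ (p (maxn N n))) _; rewrite lerD ?(ltW lN) // pe ?leq_maxr.
Qed.

(** The limit is taken pointwise. The rate is uniform in [u], which gives boundedness, and the
    linearity defect of [q] is at most [e n * K] for every [n], hence zero. *)
Lemma op_lim (p : nat -> 'B(H)) (e : nat -> R) :
    (forall m n, (n <= m)%N -> op_bound (p m - p n) (e n)) ->
    (forall d, 0 < d -> exists n, e n <= d) ->
  exists q : 'B(H), forall n, op_bound (q - p n) (e n).
Proof.
move=> pe e0.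
have en0 n : 0 <= e n by apply: op_bound_ge0 (pe n n (leqnn n)).
have /choice[q qe] : forall u, exists l, forall n, hnorm (l - p n u) <= e n * hnorm u.
  move=> u; apply: hilbert_lim => [m n mn|d d0]; first exact: (pe _ _ mn u).
  have u1 : 0 < hnorm u + 1 by rewrite ltr_wpDl ?hnorm_ge0.
  have [n en] := e0 (d / (hnorm u + 1)) (divr_gt0 d0 u1).
  exists n; apply: le_trans (ler_wpM2r (hnorm_ge0 u) en) _.
  by rewrite mulrAC ler_pdivrMr // ler_wpM2l ?(ltW d0) // lerDl.
suff qB : q \in @is_bounded_operator R H.
  by exists (BoundedOperator qB) => n u; apply: qe.
apply/asboolP; split=> [c u v|]; last first.
  have [M M0 p0M] := op_bound_exists (p 0%N).
  exists (e 0%N + M)%:C => u; rewrite !hnormE -rmorphM lecR mulrDl.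
  by rewrite -[q u](subrK (p 0%N u)) (le_trans (hnormD _ _)) ?lerD.
apply/eqP; rewrite -subr_eq0; apply/eqP/hnorm0_eq0/eqP.
rewrite eq_le hnorm_ge0 andbT; apply/ler_addgt0Pl => d d0; rewrite addr0.
set K := hnorm (c *: u + v) + normc c * hnorm u + hnorm v.
have K0 : 0 <= K by rewrite !addr_ge0 ?hnorm_ge0 // mulr_ge0 ?normc_ge0 ?hnorm_ge0.
have K1 : 0 < K + 1 by rewrite ltr_wpDl.
have [n en] := e0 (d / (K + 1)) (divr_gt0 d0 K1).
have : hnorm (q (c *: u + v) - (c *: q u + q v)) <= e n * K.
  have -> : q (c *: u + v) - (c *: q u + q v) =
     (q (c *: u + v) - p n (c *: u + v)) + (- (c *: (q u - p n u)) - (q v - p n v)).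
    by rewrite opP scalerBr !opprB [X in _ = _ + X]addrACA -opprD addrA subrK.
  apply: le_trans (hnormD _ _) _; rewrite !mulrDr -addrA; apply: lerD; first exact: qe.
  apply: le_trans (hnormD _ _) _; rewrite !hnormN hnormZ; apply: lerD; last exact: qe.
  by rewrite mulrCA ler_wpM2l ?normc_ge0.
move=> /le_trans; apply; apply: le_trans (ler_wpM2r K0 en) _.
by rewrite mulrAC ler_pdivrMr // ler_wpM2l ?(ltW d0) // lerDl.
Qed.

End HilbertOperators.

(** * Adjoints and positive operators *)

Section Adjoints.
Context {R : realType} {H : hilbertType R}.
Implicit Types (u v : H) (x y z g h : 'B(H)) (c : R[i]) (M N r e : R).
Local Notation hnorm := (snorm (@hdot R H)).
Let hdotT := @hdot_semi_inner R H.

Lemma hdotDl u v w : hdot (u + v) w = hdot u w + hdot v w :> R[i].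
Proof. exact: (semi_innerDl hdotT). Qed.
Lemma hdotDr u v w : hdot w (u + v) = hdot w u + hdot w v :> R[i].
Proof. exact: (semi_innerDr hdotT). Qed.
Lemma hdotZl c u v : hdot (c *: u) v = c * hdot u v.
Proof. exact: (semi_innerZl hdotT). Qed.
Lemma hdotZr c u v : hdot u (c *: v) = c^* * hdot u v.
Proof. exact: (semi_innerZr hdotT). Qed.
Lemma hdotBl u v w : hdot (u - v) w = hdot u w - hdot v w :> R[i].
Proof. by rewrite hdotDl -scaleN1r hdotZl mulN1r. Qed.
Lemma hdotBr u v w : hdot w (u - v) = hdot w u - hdot w v :> R[i].
Proof. by rewrite hdotDr -scaleN1r hdotZr rmorphN1 mulN1r. Qed.
Lemma hdotC u v : hdot u v = (hdot v u)^* :> R[i].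
Proof. exact: (semi_inner_conj hdotT). Qed.
Lemma hdot_sqr u : hdot u u = (hnorm u ^+ 2)%:C.
Proof. exact: (snorm_sqr hdotT). Qed.

Lemma adjoint_sym x y : is_adjoint x y -> is_adjoint y x.
Proof. by move=> xy u v; rewrite hdotC -xy -hdotC. Qed.

Lemma adjoint_unique x y z : is_adjoint x y -> is_adjoint x z -> y = z.
Proof.
move=> xy xz; apply: op_ext => u; apply/eqP; rewrite -subr_eq0; apply/eqP/hdot_eq0.
by rewrite hdotBr -xy -xz subrr.
Qed.

Lemma adjE x y : is_adjoint x y -> adj x = y.
Proof.
by move=> xy; rewrite /adj; case: xgetP => [z _ /adjoint_unique|/(_ y)//]; apply.
Qed.

Lemma adjointD x y x' y' : is_adjoint x x' -> is_adjoint y y' ->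
  is_adjoint (x + y) (x' + y').
Proof. by move=> xx yy u v; rewrite !op_addE hdotDl hdotDr xx yy. Qed.

Lemma adjointZ c x x' : is_adjoint x x' -> is_adjoint (c *: x) (c^* *: x').
Proof. by move=> xx u v; rewrite !op_scaleE hdotZl hdotZr conjCK xx. Qed.

Lemma adjointN x x' : is_adjoint x x' -> is_adjoint (- x) (- x').
Proof.
move=> xx; rewrite -[- x]scaleN1r -[- x']scaleN1r.
by rewrite -[in X in is_adjoint _ X](rmorphN1 Num.conj); apply: adjointZ.
Qed.

Lemma adjointB x y x' y' : is_adjoint x x' -> is_adjoint y y' ->
  is_adjoint (x - y) (x' - y').
Proof. by move=> xx /adjointN; apply: adjointD. Qed.

Lemma adjointM x y x' y' : is_adjoint x x' -> is_adjoint y y' ->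
  is_adjoint (x * y) (y' * x').
Proof. by move=> xx yy u v; rewrite !op_mulE xx yy. Qed.

Lemma adjoint1 : is_adjoint 1 (1 : 'B(H)).
Proof. by []. Qed.

Definition op_psd x := is_adjoint x x /\ forall u, 0 <= hdot (x u) u.

Lemma op_psd_semi_inner x : op_psd x -> semi_inner setT (fun u v => hdot (x u) v).
Proof.
move=> [xx x0]; split=> // [c u v w _ _ _|u v _ _].
  by rewrite opP hdotDl hdotZl.
by rewrite hdotC xx.
Qed.

(** Cauchy-Schwarz for the form of [x], applied to [u] and [x u], gives
    [|x u|^4 <= (r |u|^2) (r |x u|^2)]; then divide by [|x u|^2]. *)
Lemma op_psd_bound x r : op_psd x ->
  (forall u, hdot (x u) u <= (r * hnorm u ^+ 2)%:C) -> op_bound x r.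
Proof.
move=> xp xr; have xS := op_psd_semi_inner xp; set F := fun u v => _ in xS.
have r0 : 0 <= r.
  have [u u0] := @hnorm_unit R H.
  have := le_trans (xp.2 u) (xr u); rewrite ler0c pmulr_lge0 // exprn_gt0 //.
have sF u : snorm F u ^+ 2 <= r * hnorm u ^+ 2.
  by have := xr u; rewrite -[hdot _ _]/(F u u) (snorm_sqr xS) // lecR.
move=> u; have [->|xu0] := eqVneq (hnorm (x u)) 0.
  by rewrite mulr_ge0 ?hnorm_ge0.
have xup : 0 < hnorm (x u) by rewrite lt0r xu0 hnorm_ge0.
have := semi_inner_CS xS (u := u) (v := x u) I I.
rewrite {1}/F hdot_sqr normc_real ger0_norm ?sqr_ge0 // => CS.
rewrite -(ler_pXn2r (n := 2)) ?nnegrE ?mulr_ge0 ?hnorm_ge0 //.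
have xup2 : 0 < hnorm (x u) ^+ 2 by apply: exprn_gt0.
rewrite -(ler_pM2r xup2) -[X in X <= _]expr2.
have CS2 : (hnorm (x u) ^+ 2) ^+ 2 <= (snorm F u * snorm F (x u)) ^+ 2.
  by rewrite ler_pXn2r ?nnegrE ?sqr_ge0 ?mulr_ge0 ?snorm_ge0.
apply: le_trans CS2 _.
have -> : (r * hnorm u) ^+ 2 * hnorm (x u) ^+ 2 =
  r * hnorm u ^+ 2 * (r * hnorm (x u) ^+ 2) by ring.
by rewrite exprMn ler_pM ?sqr_ge0 ?sF.
Qed.

End Adjoints.

(** * Operator subalgebras and their norm closures *)

Section NormClosure.
Context {R : realType} {H : hilbertType R}.
Implicit Types (u v : H) (x y z g h : 'B(H)) (c : R[i]) (M N r e : R).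
Implicit Types (C : set 'B(H)).
Local Notation hnorm := (snorm (@hdot R H)).

Record op_subalgebra C : Prop := OpSubalgebra {
  op_subalg1 : C 1 ;
  op_subalgP : forall c x y, C x -> C y -> C (c *: x + y) ;
  op_subalgM : forall x y, C x -> C y -> C (x * y) }.

Definition norm_closure C : set 'B(H) :=
  [set x | forall e, 0 < e -> exists2 y, C y & op_bound (x - y) e].

Lemma op_bound_lim x M : (forall e, 0 < e -> op_bound x (M + e)) -> op_bound x M.
Proof.
move=> xM u; apply/ler_addgt0Pl => d d0.
have u1 : 0 < hnorm u + 1 by rewrite ltr_wpDl ?hnorm_ge0.
apply: le_trans (xM (d / (hnorm u + 1)) (divr_gt0 d0 u1) u) _.
rewrite mulrDl addrC lerD2r mulrAC ler_pdivrMr // ler_wpM2l ?(ltW d0) //.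
by rewrite lerDl.
Qed.

Lemma op_bound_eq0M x K :
  (forall e, 0 < e -> op_bound x (K * e)) -> x = 0.
Proof.
move=> xe; apply: op_bound_eq0 => e e0.
have K1 : 0 < `|K| + 1 by rewrite ltr_wpDl.
apply: op_bound_le (xe (e / (`|K| + 1)) (divr_gt0 e0 K1)) _.
rewrite mulrCA -{2}[e]mulr1 ler_wpM2l ?(ltW e0) // ler_pdivrMr // mul1r.
by rewrite (le_trans (ler_norm K)) // lerDl.
Qed.

Lemma commute_closed z C x : (forall y, C y -> z * y = y * z) ->
  norm_closure C x -> z * x = x * z.
Proof.
move=> Cz Cx; have [M M0 zM] := op_bound_exists z.
apply/eqP; rewrite -subr_eq0; apply/eqP/(op_bound_eq0M (K := 2 * M)) => e /Cx[y Cy xy].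
have -> : z * x - x * z = z * (x - y) - (x - y) * z.
  by rewrite mulrBr mulrBl (Cz y Cy) opprB addrA subrK.
apply: op_bound_le (op_boundB (op_boundM zM xy) (op_boundM xy zM)) _.
by rewrite (mulrC e) -mulrA mulr2n mulrDl mul1r.
Qed.

Lemma selfadjoint_closed C x : (forall y, C y -> is_adjoint y y) ->
  norm_closure C x -> is_adjoint x x.
Proof.
move=> CC Cx u v; apply/eqP; rewrite -subr_eq0; apply/eqP/Normc.eq0_normc/eqP.
rewrite eq_le normc_ge0 andbT; apply/ler_addgt0Pl => d d0; rewrite addr0.
set K := 2 * (hnorm u * hnorm v).
have K0 : 0 <= K by rewrite !mulr_ge0 ?hnorm_ge0.
have K1 : 0 < K + 1 by rewrite ltr_wpDl.
have [y Cy xy] := Cx (d / (K + 1)) (divr_gt0 d0 K1).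
set e := d / (K + 1) in xy.
have -> : hdot (x u) v - hdot u (x v) = hdot ((x - y) u) v - hdot u ((x - y) v).
  by rewrite !op_subE hdotBl hdotBr (CC y Cy) opprB addrA subrK.
have : normc (hdot ((x - y) u) v - hdot u ((x - y) v)) <= e * K.
  apply: le_trans (le_normcD _ _) _; rewrite normcN.
  have -> : e * K = (e * hnorm u) * hnorm v + hnorm u * (e * hnorm v) by rewrite /K; ring.
  apply: lerD; apply: le_trans (hdot_CS _ _) _.
    by rewrite ler_wpM2r ?hnorm_ge0.
  by rewrite ler_wpM2l ?hnorm_ge0.
move=> /le_trans; apply; rewrite /e mulrAC ler_pdivrMr //.
by rewrite ler_wpM2l ?(ltW d0) // lerDl.
Qed.

Lemma sub_norm_closure C : C `<=` norm_closure C.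
Proof.
move=> x Cx e e0; exists x => //; rewrite subrr.
exact: op_bound_le (op_bound0 (H := H)) (ltW e0).
Qed.

Lemma norm_closureS C D : C `<=` D -> norm_closure C `<=` norm_closure D.
Proof. by move=> CD x Cx e /Cx[y /CD]; exists y. Qed.

Lemma norm_closure_idem C : norm_closure (norm_closure C) `<=` norm_closure C.
Proof.
move=> x Cx e e0; have e2 : 0 < e / 2 by rewrite divr_gt0.
have [y /(_ _ e2)[z Cz yz] xy] := Cx _ e2; exists z => //.
have -> : x - z = x - y + (y - z) by rewrite addrA subrK.
by apply: op_bound_le (op_boundD xy yz) _; rewrite -splitr.
Qed.

Lemma norm_closure_subalgebra C : op_subalgebra C -> op_subalgebra (norm_closure C).
Proof.
move=> CC; split; first exact: (sub_norm_closure (op_subalg1 CC)).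
  move=> c x y Cx Cy e e0.
  have e2 : 0 < e / 2 by rewrite divr_gt0.
  have c1 : 0 < normc c + 1 by rewrite ltr_wpDl ?normc_ge0.
  have [x' Cx' xx'] := Cx _ (divr_gt0 e2 c1); have [y' Cy' yy'] := Cy _ e2.
  exists (c *: x' + y'); first exact: op_subalgP.
  rewrite opprD addrACA -scalerBr.
  apply: op_bound_le (op_boundD (op_boundZ _ xx') yy') _.
  rewrite [leRHS]splitr lerD2r mulrC mulrAC ler_pdivrMr // ler_wpM2l ?(ltW e2) //.
  by rewrite lerDl.
move=> x y Cx Cy e e0.
have e2 : 0 < e / 2 by rewrite divr_gt0.
have [M M0 yM] := op_bound_exists y.
have [x' Cx' xx'] := Cx _ (divr_gt0 e2 M0).
(* The product error is split as [(x - x') y + x' (y - y')], so the precision of [y'] depends on a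
   bound for the [x'] already chosen. *)
have [N N0 xN] := op_bound_exists x'.
have [y' Cy' yy'] := Cy _ (divr_gt0 e2 N0).
exists (x' * y'); first exact: op_subalgM.
rewrite -[_ - _](_ : (x - x') * y + x' * (y - y') = _); last first.
  by rewrite mulrBl mulrBr addrA subrK.
apply: op_bound_le (op_boundD (op_boundM xx' yM) (op_boundM xN yy')) _.
by rewrite divfK ?gt_eqF // [N * _]mulrC divfK ?gt_eqF // -splitr.
Qed.

Section SubalgebraTheory.
Context {C : set 'B(H)} (CC : op_subalgebra C).

Lemma op_subalg0 : C 0.
Proof. by rewrite -(addNr 1) -scaleN1r; apply: op_subalgP => //; apply: op_subalg1. Qed.

Lemma op_subalgZ c x : C x -> C (c *: x).
Proof. by move=> Cx; rewrite -[_ *: _]addr0; apply: op_subalgP => //; apply: op_subalg0. Qed.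

Lemma op_subalgD x y : C x -> C y -> C (x + y).
Proof. by move=> Cx Cy; rewrite -[x]scale1r; apply: op_subalgP. Qed.

Lemma op_subalgN x : C x -> C (- x).
Proof. by rewrite -scaleN1r; apply: op_subalgZ. Qed.

Lemma op_subalgB x y : C x -> C y -> C (x - y).
Proof. by move=> Cx /op_subalgN; apply: op_subalgD. Qed.

Lemma op_subalg_scalar c : C c%:A.
Proof. exact: (op_subalgZ _ (op_subalg1 CC)). Qed.

End SubalgebraTheory.
End NormClosure.

(** * Square roots of positive operators *)

Section SquareRoot.
Context {R : realType} {H : hilbertType R}.
Implicit Types (u v : H) (x y z g h : 'B(H)) (c : R[i]) (M N r e : R).
Implicit Types (C : set 'B(H)).
Local Notation hnorm := (snorm (@hdot R H)).

Let half : R[i] := (2^-1 : R)%:C.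

Let normc_half : normc half = 2^-1.
Proof. by rewrite normc_real ger0_norm. Qed.

Let halfD : half + half = 1.
Proof.
by rewrite /half -rmorphD; have -> : 2^-1 + 2^-1 = 1 :> R by lra.
Qed.

(* A fixed point [y] of [y |-> (g + y ^+ 2) / 2] satisfies
   [(1 - y) ^+ 2 = 1 - g]. The iterates are polynomials in [g] with nonnegative
   coefficients, so for [g] of norm at most 1 they are controlled by the scalar
   iterates at [g = 1], which increase to 1. *)
Fixpoint sqrt_approx g n : 'B(H) :=
  if n is m.+1 then half *: (g + sqrt_approx g m * sqrt_approx g m) else 0.

Fixpoint sqrt_majorant n : R :=
  if n is m.+1 then 2^-1 * (1 + sqrt_majorant m * sqrt_majorant m) else 0.

Local Notation p := sqrt_approx.
Local Notation q := sqrt_majorant.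

Lemma sqrt_majorant_bounds n : 0 <= q n <= 1.
Proof. by elim: n => [|n /andP[q0 q1]] /=; apply/andP; split; nra. Qed.

(** The gap [D = 1 - q n] evolves by [D - D^2 / 2], which is increasing on [0,1], and this map sends
    [2 / m] below [2 / (m + 1)]. *)
Lemma sqrt_majorant_rate n : 1 - q n <= 2 / n.+2%:R.
Proof.
elim: n => [|n IH] /=; first by rewrite subr0 divff.
have /andP[q0 q1] := sqrt_majorant_bounds n.
have n2 : 0 < n.+2%:R :> R by [].
have n3 : 0 < n.+3%:R :> R by [].
have E3 : n.+3%:R = n.+2%:R + 1 :> R by rewrite -natr1.
set D := 2 / n.+2%:R in IH.
have D1 : D <= 1 by rewrite /D ler_pdivrMr // mul1r ler_nat.
have D0 : 0 <= D by rewrite /D divr_ge0.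
have HD : D - 2^-1 * D * D <= 2 / n.+3%:R.
  rewrite ler_pdivlMr // E3 /D.
  have -> : (2 / n.+2%:R - 2^-1 * (2 / n.+2%:R) * (2 / n.+2%:R)) * (n.+2%:R + 1) =
     2 - 2 / n.+2%:R ^+ 2 :> R by field; rewrite -natr1 natr1.
  by rewrite lerBlDr lerDl divr_ge0 // sqr_ge0.
apply: le_trans HD; nra.
Qed.

Lemma sqrt_approx_comm g z n : z * g = g * z -> z * p g n = p g n * z.
Proof.
move=> zg; elim: n => [|n IH] /=; first by rewrite mulr0 mul0r.
rewrite -scalerAr -scalerAl mulrDr mulrDl zg; congr (_ *: (_ + _)).
by rewrite mulrA IH -mulrA IH mulrA.
Qed.

Lemma sqrt_approx_adjoint g n : is_adjoint g g -> is_adjoint (p g n) (p g n).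
Proof.
move=> gg; elim: n => [|n IH] //=.
  by rewrite -(subrr 1); apply: adjointB.
rewrite -[X in is_adjoint _ (X *: _)](conjC_real 2^-1).
by apply/adjointZ/adjointD => //; apply: adjointM.
Qed.

Lemma sqrt_approx_mem C g n : op_subalgebra C -> C g -> C (p g n).
Proof.
move=> CC Cg; elim: n => [|n IH] /=; first exact: op_subalg0.
by apply: op_subalgZ => //; apply: op_subalgD => //; apply: op_subalgM.
Qed.

Lemma sqrt_approx_bound g n : op_bound g 1 -> op_bound (p g n) (q n).
Proof.
move=> g1; elim: n => [|n IH] /=; first exact: op_bound0.
by rewrite -normc_half; apply: op_boundZ; apply: op_boundD => //; apply: op_boundM.
Qed.

(** Consecutive iterates commute, so a step factors as half of the sum times the difference of the
    two previous iterates. The majorant obeys the same identity, and bounds multiply. *)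
Lemma sqrt_approx_step g n : op_bound g 1 ->
  op_bound (p g n.+1 - p g n) (q n.+1 - q n).
Proof.
move=> g1; elim: n => [|n IH].
  rewrite /= mulr0 addr0 subr0 mul0r addr0 subr0.
  by rewrite -normc_half; apply: op_boundZ.
have com : p g n.+1 * p g n = p g n * p g n.+1.
  by apply: sqrt_approx_comm; rewrite (sqrt_approx_comm _ (erefl (g * g))).
have -> : p g n.+2 - p g n.+1 = half *: ((p g n.+1 + p g n) * (p g n.+1 - p g n)).
  rewrite mulrDl !mulrBr com addrA subrK [LHS]/= -scalerBr; congr (_ *: _).
  by rewrite opprD addrACA subrr add0r.
have -> : q n.+2 - q n.+1 = normc half * ((q n.+1 + q n) * (q n.+1 - q n)).
  by rewrite normc_half /=; ring.
apply: op_boundZ; apply: op_boundM => //.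
by apply: op_boundD; apply: sqrt_approx_bound.
Qed.

(** Telescoping the steps bounds the difference by [q m - q n], and [q m <= 1] reduces this to the
    rate of the majorant. *)
Lemma sqrt_approx_cauchy g m n : op_bound g 1 -> (n <= m)%N ->
  op_bound (p g m - p g n) (2 / n.+2%:R).
Proof.
move=> g1 nm; suff : op_bound (p g m - p g n) (q m - q n).
  move=> /op_bound_le; apply; apply: le_trans (sqrt_majorant_rate n).
  by rewrite lerD2r; case/andP: (sqrt_majorant_bounds m).
rewrite -(subnK nm); elim: (m - n)%N => [|k IH].
  by rewrite add0n !subrr; apply: op_bound0.
rewrite addSn.
have -> : p g (k + n).+1 - p g n = p g (k + n).+1 - p g (k + n) + (p g (k + n) - p g n).
  by rewrite addrA subrK.
have -> : q (k + n).+1 - q n = q (k + n).+1 - q (k + n) + (q (k + n) - q n).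
  by rewrite addrA subrK.
by apply: op_boundD => //; apply: sqrt_approx_step.
Qed.

Lemma inv_nat_small (d : R) : 0 < d -> exists n : nat, 2 / n.+2%:R <= d.
Proof.
move=> d0; exists (Num.truncn (2 / d)).
have := truncnS_gt (2 / d); set k := Num.truncn _ => kd.
rewrite ler_pdivrMr // mulrC -ler_pdivrMr //.
by apply: le_trans (ltW kd) _; rewrite ler_nat.
Qed.

(** The root is [1 - y] for the limit [y] of the iterates. Membership, self-adjointness and
    commutation pass to norm limits, and the bound 1 on [y] makes [1 - y] positive. *)
Lemma op_sqrt_contraction C g : op_subalgebra C -> norm_closure C `<=` C ->
    C g -> is_adjoint g g -> op_bound g 1 ->
  exists w, [/\ C w, op_psd w, w * w = 1 - g &
    forall z, z * g = g * z -> z * w = w * z].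
Proof.
move=> CC clC Cg gg g1.
have [y yp] := op_lim (fun m n => sqrt_approx_cauchy g1) inv_nat_small.
have yapp : norm_closure (range (p g)) y.
  by move=> e /inv_nat_small[n ne]; exists (p g n); [exists n|apply: op_bound_le ne].
have Cy : C y.
  by apply/clC/norm_closureS/yapp => _ [n _ <-]; apply: sqrt_approx_mem.
have yy : is_adjoint y y.
  by apply: selfadjoint_closed yapp => _ [n _ <-]; apply: sqrt_approx_adjoint.
have ycom z : z * g = g * z -> z * y = y * z.
  by move=> zg; apply: commute_closed yapp => _ [n _ <-]; apply: sqrt_approx_comm.
have y1 : op_bound y 1.
  apply: op_bound_lim => e /inv_nat_small[n ne].
  rewrite -[y](subrK (p g n)) addrC.
  apply: op_boundD; last exact: op_bound_le ne.
  apply: op_bound_le (sqrt_approx_bound n g1) _.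
  by case/andP: (sqrt_majorant_bounds n).
(* The fixed-point equation, from the recursion between iterates [n] and [n + 1]: two errors come
   from the square and two from [y + y], each at most [e]. *)
have yE : g + y * y = y + y.
  apply/eqP; rewrite -subr_eq0; apply/eqP/(op_bound_eq0M (K := 4)) => e /inv_nat_small[n ne].
  have pE : p g n.+1 + p g n.+1 = g + p g n * p g n.
    by rewrite /= -scalerDl halfD scale1r.
  have -> : g + y * y - (y + y) =
     (y - p g n) * y + p g n * (y - p g n) - ((y - p g n.+1) + (y - p g n.+1)).
    rewrite mulrBl mulrBr addrA subrK.
    rewrite [X in _ = _ - X]addrACA -opprD pE opprB addrA; congr (_ - _).
    by rewrite [RHS]addrC -addrA [_ + (_ - _)]addrC subrK.
  have yn : op_bound (y - p g n) e by apply: op_bound_le ne.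
  have yn1 : op_bound (y - p g n.+1) e.
    apply: op_bound_le (yp _) (le_trans _ ne).
    by rewrite ler_pM2l // lef_pV2 ?posrE // ler_nat.
  have pn1 : op_bound (p g n) 1.
    apply: op_bound_le (sqrt_approx_bound n g1) _.
    by case/andP: (sqrt_majorant_bounds n).
  apply: op_bound_le (op_boundB (op_boundD (op_boundM yn y1) (op_boundM pn1 yn))
    (op_boundD yn1 yn1)) _.
  lra.
exists (1 - y); split => //.
- by apply: op_subalgB => //; apply: op_subalg1.
- split; first exact: adjointB.
  move=> u; rewrite op_subE hdotBl op_oneE.
  have [r _ yr] : exists2 r, true & hdot (y u) u = r%:C.
    exists (complex.Re (hdot (y u) u)) => //; apply/esym/RRe_real.
    by apply/CrealP; rewrite -hdotC yy.
  rewrite yr hdot_sqr -rmorphB ler0c subr_ge0.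
  apply: le_trans (ler_norm r) _; rewrite -normc_real -yr.
  apply: le_trans (hdot_CS _ _) _; rewrite expr2 ler_wpM2r ?hnorm_ge0 //.
  by rewrite -[leRHS]mul1r y1.
- rewrite mulrBr mulr1 mulrBl mul1r -addrA -opprD addrA -yE.
  by rewrite addrK.
- by move=> z /ycom zy; rewrite mulrBr mulrBl zy mulr1 mul1r.
Qed.

(** Rescaling: with [M] a bound for [h], the operator [g = 1 - h / M] is a positive contraction, and
    the root of [1 - g = h / M] is multiplied by the square root of [M]. *)
Lemma op_sqrt C h : op_subalgebra C -> norm_closure C `<=` C ->
    C h -> op_psd h ->
  exists w, [/\ C w, op_psd w, w * w = h &
    forall z, z * h = h * z -> z * w = w * z].
Proof.
move=> CC clC Ch [hh h0]; have [M M0 hM] := op_bound_exists h.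
set g : 'B(H) := 1 - (M^-1)%:C *: h.
have gg : is_adjoint g g.
  by apply: adjointB => //; rewrite -[X in is_adjoint _ (X *: _)]conjC_real; apply: adjointZ.
have gE u : hdot (g u) u = (hnorm u ^+ 2)%:C - (M^-1)%:C * hdot (h u) u.
  by rewrite op_subE op_scaleE hdotBl hdotZl op_oneE hdot_sqr.
have gp : op_psd g.
  split=> // u; rewrite gE.
  have := hdot_CS (h u) u; have [r r0 ->] := ge0_complexP (h0 u).
  rewrite normc_real ger0_norm // => rM.
  rewrite -rmorphM -rmorphB ler0c subr_ge0 mulrC ler_pdivrMr //.
  apply: le_trans rM _; rewrite expr2 mulrC -mulrA.
  by rewrite ler_wpM2l ?hnorm_ge0 // mulrC hM.
have g1 : op_bound g 1.
  apply: op_psd_bound => // u; rewrite mul1r gE.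
  have [r r0 ->] := ge0_complexP (h0 u).
  by rewrite -rmorphM -rmorphB lecR lerBlDr lerDl mulr_ge0 // invr_ge0 ltW.
have Cg : C g by apply: op_subalgB => //; [exact: op_subalg1|apply: op_subalgZ].
have [w [Cw [ww w0] wE wcom]] := op_sqrt_contraction CC clC Cg gg g1.
have sM : (Num.sqrt M)%:C * (Num.sqrt M)%:C * (M^-1)%:C = 1 :> R[i].
  by rewrite -!rmorphM -expr2 sqr_sqrtr ?(ltW M0) // divff ?rmorph1 // gt_eqF.
exists ((Num.sqrt M)%:C *: w); split.
- exact: op_subalgZ.
- split=> [|u].
    by rewrite -[X in is_adjoint _ (X *: _)]conjC_real; apply: adjointZ.
  by rewrite op_scaleE hdotZl mulr_ge0 // ler0c sqrtr_ge0.
- rewrite -scalerAl -scalerAr wE /g opprB addrCA subrr addr0 !scalerA.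
  by rewrite sM scale1r.
- move=> z zh; rewrite -scalerAr -scalerAl wcom // /g.
  by rewrite mulrBr mulrBl mulr1 mul1r -scalerAr -scalerAl zh.
Qed.

End SquareRoot.

(** * Neumann series and invertibility from lower bounds *)

Section Invertibility.
Context {R : realType} {H : hilbertType R}.
Implicit Types (u v : H) (x y z g h : 'B(H)) (c : R[i]) (M N r e : R).
Implicit Types (C : set 'B(H)).
Local Notation hnorm := (snorm (@hdot R H)).

Lemma op_boundX g r n : op_bound g r -> op_bound (g ^+ n) (r ^+ n).
Proof.
move=> gr; elim: n => [|n IH]; first by rewrite !expr0; apply: op_bound1.
by rewrite !exprS; apply: op_boundM.
Qed.

Lemma expr_small r d : 0 <= r < 1 -> 0 < d -> exists n, r ^+ n <= d.
Proof.
move=> /andP[r0 r1] d0.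
have : \forall n \near \oo, `|r ^+ n| < d.
  have /cvgrPdist_lt/(_ d d0) : (fun n => r ^+ n) @ \oo --> (0 : R).
    by apply: cvg_expr; rewrite ger0_norm.
  by apply: filterS => n; rewrite sub0r normrN.
move=> [n _ /(_ n (leqnn n))]; exists n.
by apply: le_trans (ler_norm _) (ltW _).
Qed.

(** Neumann series: the partial sums converge in norm, and multiplying them by [1 - g] on either
    side leaves the error [g ^+ n], which tends to 0. *)
Lemma op_contraction_unit g r : op_bound g r -> r < 1 -> 1 - g \is a GRing.unit.
Proof.
move=> gr r1; have r0 := op_bound_ge0 gr.
have r1p : 0 < 1 - r by rewrite subr_gt0.
pose s n : 'B(H) := \sum_(k < n) g ^+ k.
have sE n : (1 - g) * s n = 1 - g ^+ n.
  by rewrite -opprB mulNr -subrX1 opprB.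
have sE' n : s n * (1 - g) = 1 - g ^+ n.
  rewrite -sE /s mulr_suml mulr_sumr; apply: eq_bigr => i _.
  by rewrite mulrBr mulrBl mulr1 mul1r -exprS -exprSr.
have cau m n : (n <= m)%N -> op_bound (s m - s n) (r ^+ n / (1 - r)).
  (* Keeping the exact geometric tail lets the induction on [m - n] close; the term [r ^+ m] is
     dropped afterwards. *)
  move=> nm; suff : op_bound (s m - s n) ((r ^+ n - r ^+ m) / (1 - r)).
    move=> /op_bound_le; apply; rewrite ler_pM2r ?invr_gt0 // lerBlDr lerDl.
    exact: exprn_ge0.
  rewrite -(subnK nm); elim: (m - n)%N => [|k IH].
    by rewrite add0n !subrr mul0r; apply: op_bound0.
  rewrite addSn /s big_ord_recr /= -/(s _).
  have -> : s (k + n)%N + g ^+ (k + n) - s n = s (k + n)%N - s n + g ^+ (k + n).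
    by rewrite addrAC.
  have -> : (r ^+ n - r ^+ (k + n).+1) / (1 - r) =
    (r ^+ n - r ^+ (k + n)) / (1 - r) + r ^+ (k + n).
    by rewrite exprS; field; rewrite gt_eqF.
  by apply: op_boundD => //; apply: op_boundX.
have small d : 0 < d -> exists n, r ^+ n / (1 - r) <= d.
  move=> d0; have [||n nd] := @expr_small r (d * (1 - r)); first by rewrite r0.
    exact: mulr_gt0.
  by exists n; rewrite ler_pdivrMr.
have [y yP] := op_lim cau small.
have g2 : op_bound (1 - g) 2.
  apply: op_bound_le (op_boundB (@op_bound1 R H) gr) _; lra.
have gn n : op_bound (g ^+ n) (r ^+ n / (1 - r)).
  apply: op_bound_le (op_boundX n gr) _; rewrite ler_pdivlMr //.
  by rewrite ler_piMr ?exprn_ge0 // lerBlDr lerDl.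
have left_inv : y * (1 - g) = 1.
  apply/eqP; rewrite -subr_eq0; apply/eqP/(op_bound_eq0M (K := 3)) => e /small[n ne].
  have -> : y * (1 - g) - 1 = (y - s n) * (1 - g) - g ^+ n.
    by rewrite [in RHS]mulrBl sE' opprB addrA addrAC addrK.
  by apply: op_bound_le (op_boundB (op_boundM (yP n) g2) (gn n)) _; lra.
have right_inv : (1 - g) * y = 1.
  apply/eqP; rewrite -subr_eq0; apply/eqP/(op_bound_eq0M (K := 3)) => e /small[n ne].
  have -> : (1 - g) * y - 1 = (1 - g) * (y - s n) - g ^+ n.
    by rewrite [in RHS]mulrBr sE opprB addrA addrAC addrK.
  by apply: op_bound_le (op_boundB (op_boundM g2 (yP n)) (gn n)) _; lra.
by apply/unitrP; exists y.
Qed.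

Lemma unitr_scale c x : c != 0 -> x \is a GRing.unit -> c *: x \is a GRing.unit.
Proof.
move=> c0 xU; apply/unitrP; exists (c^-1 *: x^-1).
rewrite -!scalerAl -!scalerAr !scalerA (mulVr xU) (mulrV xU).
by rewrite mulVf // mulfV // scale1r.
Qed.

(** For [N] above a bound of [h], the operator [g = 1 - h / N] is positive and bounded by
    [1 - r / N < 1], so the Neumann series inverts [1 - g = h / N]. *)
Lemma op_psd_unit h r : op_psd h -> 0 < r ->
  (forall u, (r * hnorm u ^+ 2)%:C <= hdot (h u) u) -> h \is a GRing.unit.
Proof.
move=> [hh h0] r0 hr; have [M M0 hM] := op_bound_exists h.
pose N := M + r; have N0 : 0 < N by apply: addr_gt0.
set g : 'B(H) := 1 - (N^-1)%:C *: h.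
have gg : is_adjoint g g.
  by apply: adjointB => //; rewrite -[X in is_adjoint _ (X *: _)]conjC_real; apply: adjointZ.
have gE u : hdot (g u) u = (hnorm u ^+ 2)%:C - (N^-1)%:C * hdot (h u) u.
  by rewrite op_subE op_scaleE hdotBl hdotZl op_oneE hdot_sqr.
have gp : op_psd g.
  split=> // u; rewrite gE.
  have := hdot_CS (h u) u; have [k k0 ->] := ge0_complexP (h0 u).
  rewrite normc_real ger0_norm // => kM.
  rewrite -rmorphM -rmorphB ler0c subr_ge0 mulrC ler_pdivrMr //.
  apply: le_trans kM _; rewrite expr2 mulrC -mulrA.
  rewrite ler_wpM2l ?hnorm_ge0 // mulrC.
  by apply: op_bound_le hM _ _; rewrite lerDl ltW.
have gr : op_bound g (1 - r / N).
  apply: op_psd_bound => // u; rewrite gE.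
  have := hr u; have [k k0 ->] := ge0_complexP (h0 u).
  rewrite -rmorphM -rmorphB !lecR => rk.
  by rewrite mulrBl mul1r lerD2l lerN2 mulrAC mulrC ler_pM2l ?invr_gt0.
have : 1 - g \is a GRing.unit.
  apply: op_contraction_unit gr _; rewrite ltrBlDr ltrDl; exact: divr_gt0.
rewrite opprB addrCA subrr addr0 => hU.
have -> : h = N%:C *: ((N^-1)%:C *: h).
  by rewrite scalerA -rmorphM mulfV ?gt_eqF // rmorph1 scale1r.
by apply: unitr_scale hU; rewrite fmorph_eq0 gt_eqF.
Qed.

(** Both [x' * x] and [x * x'] are positive and bounded below by [d ^+ 2], hence invertible. The
    left inverse [(x' * x)^-1 * x'] equals the right inverse [x' * (x * x')^-1]. *)
Lemma op_bounded_below_unit x x' d : is_adjoint x x' -> 0 < d ->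
    (forall u, d * hnorm u <= hnorm (x u)) ->
    (forall u, d * hnorm u <= hnorm (x' u)) ->
  x \is a GRing.unit.
Proof.
have gram y y' : is_adjoint y y' -> 0 < d ->
    (forall u, d * hnorm u <= hnorm (y u)) -> y' * y \is a GRing.unit.
  move=> yy d0 yd.
  have yE u : hdot ((y' * y) u) u = (hnorm (y u) ^+ 2)%:C.
    by rewrite op_mulE (adjoint_sym yy) hdot_sqr.
  apply: (@op_psd_unit _ (d ^+ 2)); rewrite ?exprn_gt0 //.
    split; first by apply: adjointM => //; apply: adjoint_sym.
    by move=> u; rewrite yE ler0c sqr_ge0.
  move=> u; rewrite yE lecR -exprMn ler_pXn2r ?nnegrE ?hnorm_ge0 //.
  by rewrite mulr_ge0 ?hnorm_ge0 // ltW.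
move=> xx d0 xd x'd.
have U1 := gram _ _ xx d0 xd; have U2 := gram _ _ (adjoint_sym xx) d0 x'd.
have E : (x' * x)^-1 * x' = x' * (x * x')^-1.
  by apply: (mulrI U1); rewrite mulrA mulrV // mul1r mulrA -(mulrA x') mulrK.
by apply/unitrP; exists ((x' * x)^-1 * x'); rewrite -mulrA mulVr // E mulrA mulrV.
Qed.

End Invertibility.

(** * Von Neumann algebras and tracial states *)

Section VonNeumannAlgebras.
Context {R : realType} {H : hilbertType R}.
Implicit Types (u v : H) (x y z g h : 'B(H)) (c : R[i]) (M N r e : R).
Implicit Types (A B C : set 'B(H)).

(** [star_adjointP] makes [adj] a genuine adjoint on [C] without the Riesz theorem; [star_inv] keeps
    resolvents inside [C]. *)
Record star_subalgebra C : Prop := StarSubalgebra {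
  star_subalg :> op_subalgebra C ;
  star_adjointP : forall x, C x -> is_adjoint x (adj x) ;
  star_adj : forall x, C x -> C (adj x) ;
  star_inv : forall x, C x -> x \is a GRing.unit -> C x^-1 }.

Lemma commutant_subalgebra C : op_subalgebra (commutant C).
Proof.
split.
- by move=> x _; rewrite mul1r mulr1.
- move=> c y z yC zC x Cx.
  by rewrite mulrDr mulrDl -scalerAr -scalerAl yC // zC.
- by move=> y z yC zC x Cx; rewrite mulrA yC // -mulrA zC // mulrA.
Qed.

Lemma commutant_inv C x : commutant C x -> x \is a GRing.unit -> commutant C x^-1.
Proof.
move=> xC xU y Cy; rewrite -[LHS](mulKr xU) [x * (y * _)]mulrA -xC //.
by rewrite -mulrA mulrV // mulr1.
Qed.

Lemma commutant_closed C : norm_closure (commutant C) `<=` commutant C.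
Proof. by move=> x xC y Cy; apply: commute_closed xC => z; apply. Qed.

Lemma vn_star_subalgebra A : von_neumann_algebra A -> star_subalgebra A.
Proof.
move=> [Aadj AA]; split.
- by rewrite -AA; apply: commutant_subalgebra.
- by move=> x /Aadj[y xy _]; rewrite (adjE xy).
- by move=> x /Aadj[y xy Ay]; rewrite (adjE xy).
- by rewrite -AA; apply: commutant_inv.
Qed.

Lemma vn_norm_closed A : von_neumann_algebra A -> norm_closure A `<=` A.
Proof. by move=> [_ AA]; rewrite -{2}AA -{1}AA; apply: commutant_closed. Qed.

Lemma vn_generated_mem x : vn_generated x x.
Proof. by move=> N []. Qed.

Lemma vn_generated_sub A x : von_neumann_algebra A -> A x -> vn_generated x `<=` A.
Proof. by move=> AV Ax y /(_ A); apply; split. Qed.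

Lemma vn_generated_star A x : von_neumann_algebra A -> A x ->
  star_subalgebra (vn_generated x).
Proof.
move=> AV Ax; split.
- split.
  + by move=> N [/vn_star_subalgebra NV _]; apply: op_subalg1 NV.
  + move=> c y z yx zx N NP; have [/vn_star_subalgebra NV _] := NP.
    by apply: (op_subalgP NV); [apply: yx|apply: zx].
  + move=> y z yx zx N NP; have [/vn_star_subalgebra NV _] := NP.
    by apply: (op_subalgM NV); [apply: yx|apply: zx].
- move=> y /(vn_generated_sub AV Ax) Ay.
  exact: (star_adjointP (vn_star_subalgebra AV)).
- move=> y yx N NP; have [/vn_star_subalgebra NV _] := NP.
  by apply: (star_adj NV); apply: yx.
- move=> y yx yU N NP; have [/vn_star_subalgebra NV _] := NP.
  by apply: (star_inv NV) => //; apply: yx.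
Qed.

Section AdjointAlgebra.
Context {C} (CS : star_subalgebra C).

Let adjP x : C x -> is_adjoint x (adj x) := star_adjointP CS (x := x).

Lemma adjK x : C x -> adj (adj x) = x.
Proof. by move=> Cx; apply/adjE/adjoint_sym/adjP. Qed.

Lemma adjM x y : C x -> C y -> adj (x * y) = adj y * adj x.
Proof. by move=> Cx Cy; apply/adjE/adjointM; apply: adjP. Qed.

Lemma adjD x y : C x -> C y -> adj (x + y) = adj x + adj y.
Proof. by move=> Cx Cy; apply/adjE/adjointD; apply: adjP. Qed.

Lemma adjB x y : C x -> C y -> adj (x - y) = adj x - adj y.
Proof. by move=> Cx Cy; apply/adjE/adjointB; apply: adjP. Qed.

Lemma adjZ c x : C x -> adj (c *: x) = c^* *: adj x.
Proof. by move=> Cx; apply/adjE/adjointZ; apply: adjP. Qed.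

End AdjointAlgebra.

Lemma adj_one : adj (1 : 'B(H)) = 1.
Proof. exact/adjE/adjoint1. Qed.

End VonNeumannAlgebras.

(** * The 2-norm of a faithful tracial state *)

Section TracialState.
Context {R : realType} {H : hilbertType R}.
Implicit Types (u v : H) (x y z g h : 'B(H)) (c : R[i]) (M N r e : R).
Context (A : set 'B(H)) (phi : 'B(H) -> R[i]).
Context (AV : von_neumann_algebra A) (phiS : faithful_normal_tracial_state A phi).
Local Notation hnorm := (snorm (@hdot R H)).

Let AS := vn_star_subalgebra AV.
Let adjP x : A x -> is_adjoint x (adj x) := star_adjointP AS (x := x).
Let adjA x : A x -> A (adj x) := star_adj AS (x := x).
Let A1 : A 1 := op_subalg1 AS.
Let AM x y : A x -> A y -> A (x * y) := op_subalgM AS (x := x) (y := y).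
Let AD x y : A x -> A y -> A (x + y) := op_subalgD AS (x := x) (y := y).
Let AB x y : A x -> A y -> A (x - y) := op_subalgB AS (x := x) (y := y).
Let AZ c x : A x -> A (c *: x) := op_subalgZ AS c (x := x).

Lemma stateD x y : A x -> A y -> phi (x + y) = phi x + phi y.
Proof. by move=> Ax Ay; rewrite -[x in LHS]scale1r (state_linear phiS) // mul1r. Qed.

Lemma state0 : phi 0 = 0.
Proof.
have A0 : A 0 := op_subalg0 AS.
by apply: (addrI (phi 0)); rewrite -stateD // !addr0.
Qed.

Lemma stateZ c x : A x -> phi (c *: x) = c * phi x.
Proof.
have A0 : A 0 := op_subalg0 AS.
by move=> Ax; rewrite -[_ *: _]addr0 (state_linear phiS) // state0 addr0.
Qed.

Lemma stateB x y : A x -> A y -> phi (x - y) = phi x - phi y.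
Proof.
move=> Ax Ay; rewrite stateD //; last exact: (op_subalgN AS).
by rewrite -[- y]scaleN1r stateZ // mulN1r.
Qed.

Lemma state_scalar c : phi c%:A = c.
Proof. by rewrite stateZ // (state_one phiS) mulr1. Qed.

(** The value of the state at [(1 + c x)^* (1 + c x)] is real; [c = 1] and [c = i] give the
    imaginary and the real part of the identity. *)
Lemma state_adj x : A x -> phi (adj x) = (phi x)^*.
Proof.
move=> Ax; have Aax := adjA Ax.
have Hc c : 0 <= 1 + (c * phi x + c^* * phi (adj x)) + (c^* * c) * phi (adj x * x).
  have := state_pos phiS (AD A1 (AZ c Ax)).
  rewrite (adjD AS) ?(adjZ AS) ?adj_one //; last exact: AZ.
  have -> : (1 + c^* *: adj x) * (1 + c *: x) =
      1 + (c *: x + c^* *: adj x) + (c^* * c) *: (adj x * x).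
    rewrite mulrDr !mulrDl mulr1 !mul1r mulr1 -scalerAl -scalerAr scalerA.
    by rewrite addrACA !addrA addrAC.
  have Ap : A (c *: x + c^* *: adj x) by apply: AD; apply: AZ.
  have Aq : A (adj x * x) by apply: AM.
  rewrite (stateD (AD A1 Ap) (AZ _ Aq)) (stateD A1 Ap).
  by rewrite (stateD (AZ _ Ax) (AZ _ Aax)) !stateZ // (state_one phiS).
have [r _ xr] := ge0_complexP (state_pos phiS Ax).
move: (Hc 1) (Hc 'i%R); rewrite xr conjCi rmorph1 !mul1r.
rewrite -complexiE; case: (phi x) => p1 p2; case: (phi (adj x)) => q1 q2.
rewrite -[Num.conj _]/(conjc _) /=.
rewrite !lecE /= => /andP[/eqP E1 _] /andP[/eqP E2 _].
by congr Complex; move: E1 E2; rewrite ?mulr0 ?mul0r ?mul1r; lra.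
Qed.

(** The inner product of the GNS construction; its seminorm [tn] is the 2-norm. *)
Definition state_form x y : R[i] := phi (adj y * x).
Local Notation tn := (snorm state_form).

Lemma state_semi_inner : semi_inner A state_form.
Proof.
split.
- by move=> c u v Au Av; apply: (op_subalgP AS).
- move=> c u v w Au Av Aw; have Aaw := adjA Aw; rewrite /state_form mulrDr -scalerAr.
  by rewrite (state_linear phiS) //; apply: AM.
- move=> u v Au Av; have [Aau Aav] := (adjA Au, adjA Av).
  by rewrite /state_form -state_adj ?(adjM AS) ?(adjK AS) //; apply: AM.
- by move=> u Au; apply: (state_pos phiS).
Qed.

Let tnS := state_semi_inner.

Lemma state_norm_sqr x : A x -> phi (adj x * x) = (tn x ^+ 2)%:C.
Proof. exact: (snorm_sqr tnS). Qed.

Lemma norm2E x : A x -> norm2 phi x ^+ 2 = (tn x ^+ 2)%:C.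
Proof. by move=> Ax; rewrite /norm2 sqrtCK state_norm_sqr. Qed.

Lemma tnorm1 : tn 1 = 1.
Proof.
apply/eqP; rewrite -(eqrXn2 (n := 2)) ?snorm_ge0 //; apply/eqP/complexI.
by rewrite -state_norm_sqr // adj_one mulr1 (state_one phiS) expr1n rmorph1.
Qed.

Lemma tnorm_eq0 x : A x -> tn x = 0 -> x = 0.
Proof.
by move=> Ax x0; apply: (state_faithful phiS Ax); rewrite state_norm_sqr // x0 expr0n rmorph0.
Qed.

Lemma tnorm_adj x : A x -> tn (adj x) = tn x.
Proof.
move=> Ax; apply/eqP; rewrite -(eqrXn2 (n := 2)) ?snorm_ge0 //; apply/eqP/complexI.
have Aax := adjA Ax.
by rewrite -!state_norm_sqr // (adjK AS) // (state_tracial phiS).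
Qed.

Lemma op_psd_adj (w : 'B(H)) : op_psd w -> adj w = w.
Proof. by move=> [ww _]; apply: adjE. Qed.

Lemma vn_sqrt h : A h -> op_psd h -> exists w : 'B(H), [/\ A w, adj w = w & w * w = h].
Proof.
move=> Ah /(op_sqrt AS (vn_norm_closed AV) Ah)[w [Aw wp wE _]].
by exists w; split=> //; apply: op_psd_adj.
Qed.

(** The operator [M^2 - x^* x] is positive, so it has a self-adjoint root [w] in [A], and positivity
    of the state at [(w z)^* (w z)] is the claim squared. *)
Lemma tnormM x z M : A x -> A z -> op_bound x M -> tn (x * z) <= M * tn z.
Proof.
move=> Ax Az xM; have M0 := op_bound_ge0 xM.
have [Aax Aaz] := (adjA Ax, adjA Az).
pose h := (M ^+ 2)%:C%:A - adj x * x.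
have Ah : A h by apply: AB; [apply: AZ|apply: AM].
have hp : op_psd h.
  split.
    apply: adjointB; first by rewrite -[X in is_adjoint _ (X *: _)]conjC_real; apply: adjointZ.
    by apply: adjointM; [apply: adjoint_sym|]; apply: adjP.
  move=> u; rewrite op_subE hdotBl op_scaleE op_oneE hdotZl op_mulE (adjoint_sym (adjP Ax)).
  rewrite !hdot_sqr -rmorphM -rmorphB ler0c subr_ge0 -exprMn.
  by rewrite ler_pXn2r ?nnegrE ?hnorm_ge0 ?mulr_ge0 ?hnorm_ge0 // xM.
have [w [Aw wa wE]] := vn_sqrt Ah hp.
have : 0 <= phi (adj (w * z) * (w * z)) by apply: (state_pos phiS); apply: AM.
rewrite (adjM AS) // wa mulrA -(mulrA (adj z) w w) wE mulrBr mulrBl.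
have -> : adj z * (adj x * x) * z = adj (x * z) * (x * z).
  by rewrite (adjM AS) // !mulrA.
rewrite -scalerAr -scalerAl mulr1 stateB;
  try by [apply: AZ; apply: AM|apply: AM; [apply: adjA|]; apply: AM].
rewrite stateZ; last exact: AM.
rewrite !state_norm_sqr //; last exact: AM.
rewrite -rmorphM -rmorphB ler0c subr_ge0 -exprMn.
by rewrite ler_pXn2r ?nnegrE ?snorm_ge0 ?mulr_ge0 ?snorm_ge0.
Qed.

Lemma tnorm_bound x M : A x -> op_bound x M -> tn x <= M.
Proof. by move=> Ax xM; have := tnormM Ax A1 xM; rewrite mulr1 tnorm1 mulr1. Qed.

(* If [y := d ^+ 2 - x^* x] were not negative, its positive part would be a
   nonzero element [k] of the closure of [B] with [tn (x * k) < d * tn k]. *)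
Lemma op_bounded_below (B : set 'B(H)) x d : op_subalgebra B -> B `<=` A ->
    B x -> B (adj x) -> 0 < d ->
    (forall y, B y -> d * tn y <= tn (x * y)) ->
  forall u, d * hnorm u <= hnorm (x u).
Proof.
move=> BS BA Bx Bax d0 xd.
have Ax := BA _ Bx; have Aax := adjA Ax.
set C := norm_closure B.
have CS : op_subalgebra C by apply: norm_closure_subalgebra.
have CA : C `<=` A by move=> y /(norm_closureS BA)/(vn_norm_closed AV).
have clC : norm_closure C `<=` C by apply: norm_closure_idem.
have BC : B `<=` C by apply: sub_norm_closure.
(* Replacing [y] by an approximant [z] in [B] costs at most [(d + M) * tn (y - z)], so the lower
   bound extends to the closure, which contains the square roots needed below. *)
have xdC y : C y -> d * tn y <= tn (x * y).
  move=> Cy; have Ay := CA _ Cy; have [M M0 xM] := op_bound_exists x.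
  apply/ler_addgt0Pl => e e0.
  have K0 : 0 < d + M by apply: addr_gt0.
  have [z Bz yz] := Cy _ (divr_gt0 e0 K0); have Az := BA _ Bz.
  have := xd z Bz; have := tnorm_bound (AB Ay Az) yz; set t := tn (y - z) => te.
  have yzt : tn y <= tn z + t by rewrite addrC -{1}[y](subrK z) (snormD tnS) //; apply: AB.
  have xyz : tn (x * z) <= tn (x * y) + M * t.
    rewrite -{1}[z](subKr y) mulrBr; apply: le_trans (snormD tnS _ _) _.
    - exact: AM.
    - by apply: (op_subalgN AS); apply: AM => //; apply: AB.
    rewrite lerD2l (snormN tnS); last by apply: AM => //; apply: AB.
    by apply: tnormM => //; apply: AB.
  have : (d + M) * t <= e by rewrite mulrC -ler_pdivlMr.
  nra.
pose y := (d ^+ 2)%:C%:A - adj x * x.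
have Cy : C y.
  apply: (op_subalgB CS); first exact: (op_subalg_scalar CS).
  by apply: (op_subalgM CS); apply: BC.
have yy : is_adjoint y y.
  apply: adjointB; first by rewrite -[X in is_adjoint _ (X *: _)]conjC_real; apply: adjointZ.
  by apply: adjointM; [apply: adjoint_sym|]; apply: adjP.
have y2 : op_psd (y * y).
  split; first exact: adjointM.
  by move=> u; rewrite op_mulE yy hdot_sqr ler0c sqr_ge0.
have [w [Cw wp wE wcom]] := op_sqrt CS clC (op_subalgM CS Cy Cy) y2.
have yw : y * w = w * y by apply: wcom; rewrite mulrA.
have Aw := CA _ Cw; have Ay := CA _ Cy.
have [v [Av va vE]] := vn_sqrt Aw wp.
(* Since [w] is the modulus of [y], this is twice the positive part of [y]. *)
pose k := w + y.
have Ck : C k by apply: (op_subalgD CS).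
have Ak := CA _ Ck.
have kk : adj k = k by apply/adjE/adjointD => //; case: wp.
have yk : y * k = w * k by rewrite /k (mulrDr y) (mulrDr w) yw wE addrC.
(* As [v^2 = w] and [w k = y k], the square of [tn (v * k)] is the state at [k y k], that is
   [d^2 |k|^2 - |x k|^2], which the lower bound makes nonpositive. *)
have k0 : tn (v * k) = 0.
  have := xdC k Ck.
  rewrite -(ler_pXn2r (n := 2)) ?nnegrE ?mulr_ge0 ?snorm_ge0 ?(ltW d0) // exprMn.
  have E : (tn (v * k) ^+ 2)%:C = ((d ^+ 2) * tn k ^+ 2)%:C - (tn (x * k) ^+ 2)%:C.
    have -> : (d ^+ 2 * tn k ^+ 2)%:C = (d ^+ 2)%:C * phi (adj k * k).
      by rewrite state_norm_sqr // -rmorphM.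
    rewrite -!state_norm_sqr //; try exact: AM.
    rewrite !(adjM AS) // kk va mulrA -(mulrA k v) vE -mulrA -yk mulrBl mulrBr.
    rewrite -scalerAl mul1r -scalerAr stateB ?stateZ //.
    - by rewrite !mulrA.
    - exact: AM.
    - by apply: AZ; apply: AM.
    - by do ?apply: AM.
  move: E; rewrite -rmorphB => /complexI E; rewrite -subr_le0 -E => v0.
  by apply/eqP; rewrite -sqrf_eq0 eq_le v0 sqr_ge0.
have vk := tnorm_eq0 (AM Av Ak) k0.
have wk : w * k = 0 by rewrite -vE -mulrA vk mulr0.
(* Now [w k] and [y k] both vanish, so [k^2 = 0] and faithfulness gives [k = 0]; hence
   [x^* x - d^2 = - y = w] is positive. *)
have k2 : k * k = 0 by rewrite {1}/k mulrDl yk wk addr0.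
have k00 : k = 0.
  apply: tnorm_eq0 => //; apply/eqP; rewrite -sqrf_eq0; apply/eqP/complexI.
  by rewrite -state_norm_sqr // kk k2 state0.
move=> u; rewrite -(ler_pXn2r (n := 2)) ?nnegrE ?hnorm_ge0 ?mulr_ge0 ?hnorm_ge0 ?(ltW d0) //.
have wy : w = - y by apply/eqP; rewrite -addr_eq0 -/k k00.
have := wp.2 u; rewrite wy opprB op_subE hdotBl op_scaleE op_oneE hdotZl op_mulE.
rewrite (adjoint_sym (adjP Ax)) !hdot_sqr -rmorphM -rmorphB ler0c subr_ge0.
by rewrite exprMn.
Qed.

End TracialState.

(** * Linear spans *)

Section LinearSpan.
Context {K : pzRingType} {V : lmodType K}.
Implicit Types (W : set V).

Inductive lspan W : set V :=
| lspan0 : lspan W 0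
| lspan_cons c w y : W w -> lspan W y -> lspan W (c *: w + y).

Lemma lspan_mem W w : W w -> lspan W w.
Proof.
move=> Ww; rewrite -[w]scale1r -[_ *: _]addr0.
by apply: lspan_cons => //; apply: lspan0.
Qed.

Lemma lspanD W x y : lspan W x -> lspan W y -> lspan W (x + y).
Proof.
move=> Wx Wy; elim: Wx => [|c w z Ww _ IH]; first by rewrite add0r.
by rewrite -addrA; apply: lspan_cons.
Qed.

Lemma lspanZ W c x : lspan W x -> lspan W (c *: x).
Proof.
elim=> [|d w z Ww _ IH]; first by rewrite scaler0; apply: lspan0.
by rewrite scalerDr scalerA; apply: lspan_cons.
Qed.

Lemma lspanB W x y : lspan W x -> lspan W y -> lspan W (x - y).
Proof. by move=> Wx Wy; apply: lspanD => //; rewrite -scaleN1r; apply: lspanZ. Qed.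

Lemma lspan_sub W (W' : set V) : W `<=` lspan W' -> lspan W `<=` lspan W'.
Proof.
move=> WW x; elim=> [|c w z /WW Ww _ IH]; first exact: lspan0.
by apply: lspanD => //; apply: lspanZ.
Qed.

End LinearSpan.

(** * Reduced words in free subalgebras *)

Section FreeWords.
Context {R : realType} {H : hilbertType R}.
Implicit Types (u v : H) (x y z g h : 'B(H)) (c : R[i]) (M N r e : R).
Implicit Types (i j k : bool).
Context (A : set 'B(H)) (phi : 'B(H) -> R[i]).
Context (AV : von_neumann_algebra A) (phiS : faithful_normal_tracial_state A phi).
Context (A1 A2 : set 'B(H)).
Context (A1S : star_subalgebra A1) (A2S : star_subalgebra A2).
Context (A1A : A1 `<=` A) (A2A : A2 `<=` A).
Context (freeA : free_subalgebras phi A1 A2).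
Local Notation tn := (snorm (state_form phi)).

Let AS := vn_star_subalgebra AV.
Let adjA x : A x -> A (adj x) := star_adj AS (x := x).
Let AM x y : A x -> A y -> A (x * y) := op_subalgM AS (x := x) (y := y).
Let AB x y : A x -> A y -> A (x - y) := op_subalgB AS (x := x) (y := y).
Let AZ c x : A x -> A (c *: x) := op_subalgZ AS c (x := x).
Let tnS := state_semi_inner AV phiS.

Definition factor i := if i then A1 else A2.

Definition centered i : set 'B(H) := [set x | factor i x /\ phi x = 0].

(* A word is encoded as a list of operators tagged with the factor they come
   from; it is reduced when its letters are centered and adjacent tags differ. *)
Implicit Types (l : bool * 'B(H)) (s t : seq (bool * 'B(H))).

Fixpoint letters s : Prop := if s is l :: t then centered l.1 l.2 /\ letters t else True.

(** Starting the path at [i] also forces the first letter of [s] to carry the other tag. *)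
Definition alternating_from i s := path (fun j k => j != k) i (unzip1 s).

Definition word_prod s : 'B(H) := \prod_(l <- s) l.2.

Definition words_from i : set 'B(H) :=
  [set w | exists x s, [/\ letters ((i, x) :: s), alternating_from i s &
    w = word_prod ((i, x) :: s)]].

(** The empty word is included, so that the unit lies in [span_not_from i] for both tags. *)
Definition words_not_from i : set 'B(H) :=
  [set w | exists s, [/\ letters s, alternating_from i s & w = word_prod s]].

Definition span_from i := lspan (words_from i).
Definition span_not_from i := lspan (words_not_from i).

Lemma factor_star i : star_subalgebra (factor i). Proof. by case: i. Qed.

Lemma factor_sub i : factor i `<=` A. Proof. by case: i. Qed.

Lemma centered_adj i x : centered i x -> centered i (adj x).
Proof.
move=> [Fx x0]; split; first exact: (star_adj (factor_star i)).
by rewrite (state_adj AV phiS (factor_sub Fx)) x0 rmorph0.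
Qed.

Lemma centered_part i x : factor i x -> centered i (x - (phi x)%:A).
Proof.
move=> Fx; have FS := factor_star i; split.
  by apply: (op_subalgB FS) => //; apply: (op_subalg_scalar FS).
rewrite (stateB AV phiS (factor_sub Fx)) ?(state_scalar AV phiS) ?subrr //.
exact: (op_subalg_scalar AS).
Qed.

Lemma word_prod_cons l s : word_prod (l :: s) = l.2 * word_prod s.
Proof. by rewrite /word_prod big_cons. Qed.

Lemma letters_nth s (j : nat) : letters s -> (j < size s)%N ->
  centered (nth (true, 0) s j).1 (nth (true, 0) s j).2.
Proof.
by elim: s j => [//|l s IH] [|j] [cl ls] js //; apply: IH.
Qed.

Lemma word_prod_mem s : letters s -> A (word_prod s).
Proof.
elim: s => [_|l s IH /= [[Fl _] ls]].
  by rewrite /word_prod big_nil; apply: op_subalg1 AS.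
by rewrite word_prod_cons; apply: AM; [apply: factor_sub Fl|apply: IH].
Qed.

Lemma state_word l s : letters (l :: s) -> alternating_from l.1 s ->
  phi (word_prod (l :: s)) = 0.
Proof.
move=> ls /(pathP true) alt; rewrite /word_prod (big_nth (true, 0)).
apply: (freeA (i := fun n => (nth (true, 0) (l :: s) n).1)
  (x := fun n => (nth (true, 0) (l :: s) n).2)) => // n ns.
- by have [] := letters_nth ls ns.
- by have [] := letters_nth ls ns.
have := alt n; rewrite size_map => /(_ ns).
rewrite (nth_map (true, 0)) //.
by case: n ns => [|n] ns //=; rewrite (nth_map (true, 0)) // ltnW.
Qed.

(** Induction on [s]: the adjoint of its first letter moves to the front of [l :: t]. The tags there
    differ, so the longer word is still reduced, and freeness applies once [s] is exhausted. *)
Lemma state_word_adj s l t : letters s -> alternating_from l.1 s ->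
    letters (l :: t) -> alternating_from l.1 t ->
  phi (adj (word_prod s) * word_prod (l :: t)) = 0.
Proof.
elim: s l t => [|m s IH] l t ls alts lt altt.
  by rewrite {1}/word_prod big_nil adj_one mul1r; apply: state_word.
case: ls => cm ls; have [Fm _] := cm.
rewrite [X in adj X]word_prod_cons (adjM AS (factor_sub Fm) (word_prod_mem ls)).
case/andP: alts => lm alts.
have -> : adj (word_prod s) * adj m.2 * word_prod (l :: t) =
  adj (word_prod s) * word_prod ((m.1, adj m.2) :: l :: t).
  by rewrite [in RHS]word_prod_cons mulrA.
apply: IH => //; first by split=> //; apply: centered_adj.
by rewrite /alternating_from /= eq_sym lm.
Qed.

Lemma words_from_not i : words_from i `<=` words_not_from (~~ i).
Proof.
move=> _ [x [s [ls alts ->]]]; exists ((i, x) :: s); split=> //.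
by rewrite /alternating_from /= -/(alternating_from i s) alts andbT; case: (i).
Qed.

Lemma span_from_not i : span_from i `<=` span_not_from (~~ i).
Proof. by apply: lspan_sub => w /words_from_not; apply: lspan_mem. Qed.

Lemma lspan_dom (W : set 'B(H)) : W `<=` A -> lspan W `<=` A.
Proof.
move=> WA x; elim=> [|c w z /WA Aw _ Az]; first exact: (op_subalg0 AS).
exact: (op_subalgP AS).
Qed.

Lemma words_not_from_sub i : words_not_from i `<=` A.
Proof. by move=> _ [s [ls _ ->]]; apply: word_prod_mem. Qed.

Lemma words_from_sub i : words_from i `<=` A.
Proof. by move=> w /words_from_not/words_not_from_sub. Qed.

Lemma span_not_from_sub i : span_not_from i `<=` A.
Proof. exact/lspan_dom/words_not_from_sub. Qed.

Lemma span_from_sub i : span_from i `<=` A.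
Proof. exact/lspan_dom/words_from_sub. Qed.

Lemma span_orthogonal i x y : span_from i x -> span_not_from i y ->
  state_form phi x y = 0.
Proof.
move=> Lx Ky; elim: Lx => [|c w z Ww Wz IH].
  by rewrite (semi_inner0l tnS) //; apply: span_not_from_sub Ky.
have Aw := words_from_sub Ww; have Az := span_from_sub Wz; have Ay := span_not_from_sub Ky.
rewrite (semi_inner_lin tnS) // IH addr0; apply/eqP; rewrite mulf_eq0; apply/orP; right.
apply/eqP; elim: Ky => [|d v y' Wv Wy' IHy].
  by rewrite (semi_inner_conj tnS) ?(semi_inner0l tnS) ?rmorph0 //; apply: (op_subalg0 AS).
have Av := words_not_from_sub Wv; have Ay' := span_not_from_sub Wy'.
rewrite (semi_innerDr tnS) //; last exact: AZ.
rewrite (semi_innerZr tnS) // IHy addr0.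
have [a [s [ls alts ->]]] := Ww; have [t [lt altt ->]] := Wv.
by rewrite /state_form state_word_adj ?mulr0.
Qed.

Lemma centered_mul_span i x y : centered i x -> span_not_from i y -> span_from i (x * y).
Proof.
move=> cx; elim=> [|c w z [s [ls alts ->]] _ IH]; first by rewrite mulr0; apply: lspan0.
rewrite mulrDr -scalerAr; apply: lspan_cons => //.
by exists x, s; split=> //; rewrite word_prod_cons.
Qed.

(** Write [x^* x] as its state plus a centered element of factor [i]. The centered part sends [y]
    into [span_from i], orthogonal to [y], so only the scalar [|x|^2] contributes to [|x y|^2]. *)
Lemma tnorm_centered_mul i x y : centered i x -> span_not_from i y ->
  tn (x * y) = tn x * tn y.
Proof.
move=> cx Ky; have [Fx x0] := cx; have FS := factor_star i.
have Ax := factor_sub Fx; have Ay := span_not_from_sub Ky; have Axy := AM Ax Ay.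
apply/eqP; rewrite -(eqrXn2 (n := 2)) ?mulr_ge0 ?snorm_ge0 //; apply/eqP/complexI.
rewrite exprMn -(state_norm_sqr AV phiS) // (adjM AS) //.
have [Aax Aay] := (adjA Ax, adjA Ay).
have Fxx : factor i (adj x * x) by apply: (op_subalgM FS) => //; apply: (star_adj FS).
have := span_orthogonal (centered_mul_span (centered_part Fxx) Ky) Ky.
rewrite /state_form mulrBl mulrBr -scalerAl mul1r -scalerAr.
have Axx := AM Aax Ax; have Axxy := AM Axx Ay; have Ayy := AM Aay Ay.
rewrite (stateB AV phiS) ?(stateZ AV phiS) //; try by [apply: AZ|apply: AM].
move=> /eqP; rewrite subr_eq0 => /eqP E.
have -> : adj y * adj x * (x * y) = adj y * (adj x * x * y) by rewrite !mulrA.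
by rewrite E !(state_norm_sqr AV phiS) // -rmorphM.
Qed.

Definition word_span := lspan [set w | exists i, words_not_from i w].

Lemma span_not_from_word i : span_not_from i `<=` word_span.
Proof. by apply: lspan_sub => w Ww; apply: lspan_mem; exists i. Qed.

Lemma span_from_word i : span_from i `<=` word_span.
Proof. by move=> x /span_from_not/span_not_from_word. Qed.

Lemma word_span_sub : word_span `<=` A.
Proof. by apply: lspan_dom => w [i /words_not_from_sub]. Qed.

Lemma span_not_from1 i : span_not_from i 1.
Proof. by apply: lspan_mem; exists [::]; split=> //; rewrite /word_prod big_nil. Qed.

Lemma word_cases i w : (exists j, words_not_from j w) ->
  words_not_from i w \/ words_from i w.
Proof.
move=> [j [[|[k x] s] [ls alts ->]]]; first by left; exists [::].
have [ki|ki] := eqVneq k i; last first.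
  left; exists ((k, x) :: s); split=> //; move: alts => /= /andP[_ alts].
  by rewrite /alternating_from /= eq_sym ki.
right; rewrite -ki; exists x, s; split=> //.
by move: alts => /andP[].
Qed.

Lemma word_span_decomp i y : word_span y ->
  exists y1 y2, [/\ span_not_from i y1, span_from i y2 & y = y1 + y2].
Proof.
elim=> [|c w z Ww _ [y1 [y2 [Ky1 Ly2 ->]]]].
  by exists 0, 0; split; [apply: lspan0|apply: lspan0|rewrite addr0].
have [Kw|Lw] := word_cases i Ww.
  by exists (c *: w + y1), y2; split=> //; [apply: lspan_cons|rewrite addrA].
by exists y1, (c *: w + y2); split=> //; [apply: lspan_cons|rewrite addrCA].
Qed.

(** If the word starts in factor [i], its first letter is merged into [x]. The element in front is
    then split into a centered part, which extends the word, and a scalar. *)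
Lemma factor_mul_word i x y : factor i x -> word_span y -> word_span (x * y).
Proof.
move=> Fx; have FS := factor_star i.
have step z t : factor i z -> letters t -> alternating_from i t ->
    word_span (z * word_prod t).
  move=> Fz lt altt.
  have -> : z * word_prod t =
      (z - (phi z)%:A) * word_prod t + phi z *: word_prod t.
    by rewrite mulrBl -scalerAl mul1r subrK.
  have Kt : span_not_from i (word_prod t) by apply: lspan_mem; exists t.
  apply: lspanD; last exact/lspanZ/span_not_from_word/Kt.
  exact/span_from_word/centered_mul_span/Kt/centered_part.
elim=> [|c w z Ww _ IH]; first by rewrite mulr0; apply: lspan0.
rewrite mulrDr -scalerAr; apply: lspanD => //; apply: lspanZ.
have [[s [ls alts ->]]|[a [s [[[Fa _] ls] alts ->]]]] := word_cases i Ww.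
  exact: step.
by rewrite word_prod_cons mulrA; apply: step => //; apply: (op_subalgM FS).
Qed.

Lemma factor_word i : factor i `<=` word_span.
Proof.
move=> x Fx; rewrite -[x]mulr1; apply: factor_mul_word Fx _.
exact: (span_not_from_word (span_not_from1 i)).
Qed.

Lemma word_span_subalgebra : op_subalgebra word_span.
Proof.
split; first exact: (span_not_from_word (span_not_from1 true)).
  by move=> c x y Wx Wy; apply: lspanD => //; apply: lspanZ.
move=> x y Wx Wy; elim: Wx => [|c w z [i [s [ls _ ->]]] _ IH].
  by rewrite mul0r; apply: lspan0.
rewrite mulrDl -scalerAl; apply: lspanD => //; apply: lspanZ.
elim: s ls => [_|l s IHs /= [[Fl _] ls]]; first by rewrite /word_prod big_nil mul1r.
by rewrite word_prod_cons -mulrA; apply: factor_mul_word Fl _; apply: IHs.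
Qed.

(* In the decomposition of [word_span] into [span_not_from (~~ i)] and
   [span_from (~~ i)], the operator [x * y] is block triangular, and its two
   diagonal blocks have norm at most [tn x * tn y]; for the second block this is
   seen on its adjoint, the restriction of [adj y * adj x]. *)
Lemma block_bounded_below i x y : centered i x -> centered (~~ i) y ->
    tn x * tn y < 1 ->
  exists2 d, 0 < d & forall z, word_span z -> d * tn z <= tn ((1 - x * y) * z).
Proof.
move=> cx cy; set kap := tn x * tn y => kap1.
have kap0 : 0 <= kap by rewrite mulr_ge0 ?snorm_ge0.
have [[Fx _] [Fy _]] := (cx, cy).
have Ax := factor_sub Fx; have Ay := factor_sub Fy; have Axy := AM Ax Ay.
have [M M0 xyM] := op_bound_exists (x * y).
pose Q := 1 - kap; have Q0 : 0 < Q by rewrite subr_gt0.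
(* With [t] the norm of the image, the proof reaches [Q |z2| <= t] and [Q |z1| <= t + M |z2|], so
   that [Q^2 (|z1| + |z2|) <= (2 Q + M) t]. *)
exists (Q ^+ 2 / (2 * Q + M)).
  by rewrite divr_gt0 ?exprn_gt0 // addr_gt0 // mulr_gt0.
move=> z /(word_span_decomp (~~ i))[z1 [z2 [Kz1 Lz2 ->]]].
have Lyz1 := centered_mul_span cy Kz1.
have Kyz1 : span_not_from i (y * z1) by rewrite -(negbK i); apply: span_from_not.
have Kxyz1 := span_from_not (centered_mul_span cx Kyz1).
have nxyz1 : tn (x * (y * z1)) = kap * tn z1.
  by rewrite (tnorm_centered_mul cx Kyz1) (tnorm_centered_mul cy Kz1) mulrA.
(* [D] is the diagonal block of [x * y] applied to [z2], and [X] the off-diagonal part. *)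
have [X [D [KX LD E]]] : exists X D,
    [/\ span_not_from (~~ i) X, span_from (~~ i) D & x * (y * z2) = X + D].
  apply: word_span_decomp; apply: factor_mul_word Fx _; apply: factor_mul_word Fy _.
  exact: span_from_word Lz2.
have Az1 := span_not_from_sub Kz1; have Az2 := span_from_sub Lz2.
have AX := span_not_from_sub KX; have AD := span_from_sub LD.
have XD := span_orthogonal LD KX.
(* Orthogonality of [X] and [D] gives [|D|^2 = <x y z2, D> = <z2, y^* x^* D>], and the last vector
   has norm [kap * tn D]; conclude by Cauchy-Schwarz. *)
have nD : tn D <= kap * tn z2.
  have KD : span_not_from i D by rewrite -(negbK i); apply: span_from_not.
  have Kw := span_from_not (centered_mul_span (centered_adj cx) KD).
  have nw : tn (adj y * (adj x * D)) = kap * tn D.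
    rewrite (tnorm_centered_mul (centered_adj cy) Kw).
    rewrite (tnorm_centered_mul (centered_adj cx) KD) mulrA.
    by rewrite !(tnorm_adj AV phiS) // (mulrC (tn y)).
  have Aw : A (adj y * (adj x * D)) by apply: AM (AM _ _) => //; apply: adjA.
  have Ezw : state_form phi z2 (adj y * (adj x * D)) = (tn D ^+ 2)%:C.
    rewrite -(state_norm_sqr AV phiS) //.
    have [Aax Aay] := (adjA Ax, adjA Ay).
    rewrite /state_form (adjM AS) ?(adjK AS) //; last exact: AM.
    rewrite (adjM AS) // (adjK AS) // -!mulrA E.
    rewrite -[LHS]/(state_form phi (X + D) D) (semi_innerDl tnS) //.
    by rewrite (semi_inner_conj tnS) // XD rmorph0 add0r.
  have := semi_inner_CS tnS Az2 Aw.
  rewrite Ezw normc_real ger0_norm ?sqr_ge0 // nw.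
  have [->|D0] := eqVneq (tn D) 0; first by rewrite mulr_ge0 ?snorm_ge0.
  have Dp : 0 < tn D by rewrite lt0r D0 snorm_ge0.
  by rewrite expr2 mulrA ler_pM2r // mulrC.
have nX : tn X <= M * tn z2.
  apply: le_trans (tnormM AV phiS Axy Az2 xyM).
  rewrite -mulrA E -(ler_pXn2r (n := 2)) ?nnegrE ?snorm_ge0 //.
  by rewrite addrC (snorm_pythagoras tnS) // lerDr sqr_ge0.
(* [P] and [z2 - D] are the two orthogonal components of the image of [z1 + z2], so each has norm at
   most [t]. *)
pose P := z1 - x * (y * z1) - X.
have KP : span_not_from (~~ i) P by do 2!apply: lspanB => //.
have LQ : span_from (~~ i) (z2 - D) by apply: lspanB.
have AP := span_not_from_sub KP; have AQ := span_from_sub LQ.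
have -> : (1 - x * y) * (z1 + z2) = (z2 - D) + P.
  rewrite /P mulrBl mul1r mulrDr -!mulrA E [z1 + z2]addrC !opprD !addrA.
  by rewrite -!addrA; congr (_ + _); rewrite [RHS]addrC -!addrA; congr (_ + (_ + _)).
have t0 := snorm_pythagoras tnS AQ AP (span_orthogonal LQ KP).
set t := tn (_ + P) in t0 *.
have tp : 0 <= t by apply: snorm_ge0.
have tQ : tn (z2 - D) <= t.
  by rewrite -(ler_pXn2r (n := 2)) ?nnegrE ?snorm_ge0 // t0 lerDl sqr_ge0.
have tP : tn P <= t.
  by rewrite -(ler_pXn2r (n := 2)) ?nnegrE ?snorm_ge0 // t0 lerDr sqr_ge0.
have z2t : Q * tn z2 <= t.
  have := snormB tnS Az2 AD; rewrite /Q; lra.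
have z1t : Q * tn z1 <= t + M * tn z2.
  have Axyz1 := span_not_from_sub Kxyz1.
  have := snormB tnS (AB Az1 Axyz1) AX; have := snormB tnS Az1 Axyz1.
  rewrite -/P nxyz1 /Q; lra.
have zt := snormD tnS Az1 Az2.
rewrite mulrAC ler_pdivrMr; last by rewrite addr_gt0 // mulr_gt0.
have : Q ^+ 2 * tn (z1 + z2) <= Q ^+ 2 * (tn z1 + tn z2) by rewrite ler_pM2l ?exprn_gt0.
have : Q * (Q * tn z1) <= Q * (t + M * tn z2) by rewrite ler_pM2l.
have : M * (Q * tn z2) <= M * t by rewrite ler_pM2l.
have : Q * (Q * tn z2) <= Q * t by rewrite ler_pM2l.
rewrite /Q; lra.
Qed.

(** The adjoint [1 - adj y * adj x] has the same shape with the factors exchanged and the same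
    product of 2-norms. So both operators are bounded below on [word_span], hence on [H]. *)
Lemma free_product_unit i x y : centered i x -> centered (~~ i) y ->
  tn x * tn y < 1 -> 1 - x * y \is a GRing.unit.
Proof.
move=> cx cy xy1; have [[Fx _] [Fy _]] := (cx, cy).
have Ax := factor_sub Fx; have Ay := factor_sub Fy; have Axy := AM Ax Ay.
have Aa1 : A 1 := op_subalg1 AS.
have WS := word_span_subalgebra.
have aE : adj (1 - x * y) = 1 - adj y * adj x.
  by rewrite (adjB AS) // adj_one (adjM AS).
have Bx : word_span (1 - x * y).
  apply: (op_subalgB WS); first exact: (op_subalg1 WS).
  by apply: (op_subalgM WS); apply: factor_word; eassumption.
have Bax : word_span (adj (1 - x * y)).
  rewrite aE; apply: (op_subalgB WS); first exact: (op_subalg1 WS).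
  apply: (op_subalgM WS); apply: factor_word.
    by apply: (star_adj (factor_star _)); eassumption.
  by apply: (star_adj (factor_star _)); eassumption.
have [d1 d10 Hd1] := block_bounded_below cx cy xy1.
have [d2 d20 Hd2] : exists2 d, 0 < d &
    forall z, word_span z -> d * tn z <= tn ((1 - adj y * adj x) * z).
  apply: (@block_bounded_below (~~ i)); rewrite ?negbK; try exact: centered_adj.
  by rewrite !(tnorm_adj AV phiS) // mulrC.
have H1 := op_bounded_below AV phiS WS word_span_sub Bx Bax d10 Hd1.
have AxyB : A (1 - x * y) by apply: word_span_sub.
rewrite -aE in Hd2.
have H2 := op_bounded_below AV phiS WS word_span_sub Bax.
rewrite (adjK AS) // in H2; have {}H2 := H2 _ Bx d20 Hd2.
have d0 : 0 < Num.min d1 d2 by rewrite lt_min d10.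
apply: (op_bounded_below_unit (star_adjointP AS AxyB) d0) => u.
  by apply: le_trans (H1 u); rewrite ler_wpM2r ?hnorm_ge0 // ge_min lexx.
by apply: le_trans (H2 u); rewrite ler_wpM2r ?hnorm_ge0 // ge_min lexx orbT.
Qed.

(* The partial sums [z n] of the geometric series of [T := x * y] satisfy
   [tn (z n) ^+ 2 = n], whereas [(1 - T) * z n = 1 - T ^+ n] stays bounded. *)
Lemma free_product_not_unit i x y : centered i x -> centered (~~ i) y ->
  tn x * tn y = 1 -> 1 - x * y \isn't a GRing.unit.
Proof.
move=> cx cy xy1; apply/negP => U; have [[Fx _] [Fy _]] := (cx, cy).
have Ax := factor_sub Fx; have Ay := factor_sub Fy; have Axy := AM Ax Ay.
have A1' : A 1 := op_subalg1 AS.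
have step z : span_not_from (~~ i) z ->
    span_from i (x * y * z) /\ tn (x * y * z) = tn z.
  move=> Kz; have Kyz : span_not_from i (y * z).
    by rewrite -(negbK i); apply/span_from_not/centered_mul_span.
  rewrite -mulrA; split; first exact: centered_mul_span.
  by rewrite (tnorm_centered_mul cx Kyz) (tnorm_centered_mul cy Kz) mulrA xy1 mul1r.
have pow n : span_not_from (~~ i) ((x * y) ^+ n) /\ tn ((x * y) ^+ n) = 1.
  elim: n => [|n [Kn nn]].
    by rewrite expr0 (tnorm1 AV phiS); split=> //; apply: span_not_from1.
  by rewrite exprS; have [/span_from_not ? ->] := step _ Kn.
pose z n : 'B(H) := \sum_(k < n) (x * y) ^+ k.
have zP n : span_not_from (~~ i) (z n) /\ tn (z n) ^+ 2 = n%:R.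
  elim: n => [|n [Kn nn]].
    rewrite /z big_ord0; split; first exact: lspan0.
    by rewrite -(scale0r 1) (snormZ tnS) // Normc.normc0 mul0r expr0n.
  (* In this form the first summand lies in [span_from i] and is orthogonal to 1, so the squared
     norm grows by exactly 1. *)
  have -> : z n.+1 = x * y * z n + 1.
    rewrite /z big_ord_recl expr0 addrC mulr_sumr; congr (_ + _).
    by apply: eq_bigr => k _; rewrite exprS.
  have [Lz nz] := step _ Kn; split.
    by apply: lspanD; [apply: span_from_not|apply: span_not_from1].
  rewrite (snorm_pythagoras tnS) //; last first.
  - exact: span_orthogonal Lz (span_not_from1 i).
  - exact: span_from_sub Lz.
  by rewrite nz nn (tnorm1 AV phiS) expr1n natr1.
have [M M0 UM] := op_bound_exists (1 - x * y)^-1.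
have AU : A (1 - x * y)^-1 by apply: (star_inv AS) => //; apply: AB.
have zM n : tn (z n) <= M * 2.
  have -> : z n = (1 - x * y)^-1 * (1 - (x * y) ^+ n).
    have <- : (1 - x * y) * z n = 1 - (x * y) ^+ n.
      by rewrite -opprB mulNr -subrX1 opprB.
    by rewrite mulKr.
  have [Kn nn] := pow n; have An := span_not_from_sub Kn.
  apply: le_trans (tnormM AV phiS AU (AB A1' An) UM) _.
  rewrite ler_wpM2l ?(ltW M0) //; apply: le_trans (snormD tnS _ _) _ => //.
    exact: (op_subalgN AS).
  by rewrite (snormN tnS) // nn (tnorm1 AV phiS).
pose n := (Num.truncn ((M * 2) ^+ 2)).+1.
have := truncnS_gt ((M * 2) ^+ 2); rewrite -/n -(zP n).2 ltNge => /negP; apply.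
by rewrite ler_pXn2r ?nnegrE ?snorm_ge0 ?zM // mulr_ge0 // ltW.
Qed.

End FreeWords.

(** * Spectra, resolvents and the factorization *)

Section Resolvents.
Context {R : realType} {H : hilbertType R}.
Implicit Types (x y : 'B(H)) (c z : R[i]) (A : set 'B(H)).

(** [A] contains the inverses of its units, so the spectrum relative to [A] is governed by
    invertibility in ['B(H)]. *)
Lemma not_spectrumP A x z : star_subalgebra A -> A x ->
  (z%:A - x \is a GRing.unit) <-> ~ spectrum A x z.
Proof.
move=> AS Ax; split=> [U|]; last first.
  by move=> /contrapT[y Ay yP]; apply/unitrP; exists y.
apply; exists (z%:A - x)^-1; last by rewrite mulVr // mulrV.
by apply: (star_inv AS) => //; apply: (op_subalgB AS) => //; apply: (op_subalg_scalar AS).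
Qed.

Lemma resolvent_unit A x z : star_subalgebra A -> A x -> z != 0 ->
  ((normc z)%:E < (spectral_radius A x)^-1)%E -> 1 - z *: x \is a GRing.unit.
Proof.
move=> AS Ax z0 zr.
have -> : 1 - z *: x = z *: (z^-1%:A - x).
  by rewrite scalerBr scalerA mulfV // scale1r.
apply: unitr_scale => //; apply/(not_spectrumP _ AS Ax) => sp.
have nz0 : 0 < normc z by rewrite normc_gt0.
have : ((normc z^-1)%:E <= spectral_radius A x)%E.
  by apply: ereal_sup_ubound; exists z^-1.
(* A spectral value [z^-1] forces [|z|^-1 <= rho]. For [rho = 0] the inverse is infinite and the
   contradiction is [|z|^-1 > 0]; for infinite [rho] the hypothesis reads [|z| < 0]. *)
rewrite Normc.normcV; case: (spectral_radius A x) zr => [r||].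
- rewrite inver lee_fin; case: eqP => [-> _|/eqP r0].
    by rewrite leNgt invr_gt0 nz0.
  rewrite lte_fin => zr zr'.
  have rp : 0 < r by apply: lt_le_trans zr'; rewrite invr_gt0.
  have : normc z < normc z.
    by apply: lt_le_trans zr _; rewrite -(invrK (normc z)) lef_pV2 ?posrE ?invr_gt0.
  by rewrite ltxx.
- by rewrite invey lte_fin ltNge normc_ge0.
- by rewrite leeNy_eq.
Qed.

(** From [X (X^-1 - f) = 1 - f X] and [(Y^-1 - g) Y = 1 - g Y], the triple product collapses to
    [(f X + g Y - 1) / (f g)]. As [s f = t g], the numerator is [(f + g - 1) - s f (a + b)]. *)
Lemma resolvent_factorization (a b : 'B(H)) (s t f g : R[i]) :
    1 - s *: a \is a GRing.unit -> 1 - t *: b \is a GRing.unit ->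
    s * f = t * g -> s * f != 0 ->
  ((f + g - 1) / (s * f))%:A - a - b =
  (g / s) *: ((1 - s *: a)
    * (1 - (f * g)^-1 *: (((1 - s *: a)^-1 - f%:A) * ((1 - t *: b)^-1 - g%:A)))
    * (1 - t *: b)).
Proof.
set X := 1 - s *: a; set Y := 1 - t *: b => XU YU sf sf0.
have [s0 f0] : s != 0 /\ f != 0 by move: sf0; rewrite mulf_eq0 negb_or => /andP[].
have [t0 g0] : t != 0 /\ g != 0 by move: sf0; rewrite sf mulf_eq0 negb_or => /andP[].
have E (x y : 'B(H)) : x \is a GRing.unit -> y \is a GRing.unit ->
    x * (1 - (f * g)^-1 *: ((x^-1 - f%:A) * (y^-1 - g%:A))) * y =
    (f * g)^-1 *: (f *: x + g *: y - 1).
  move=> xU yU; rewrite mulrBr mulrBl mulr1 -scalerAr -scalerAl.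
  have -> : x * ((x^-1 - f%:A) * (y^-1 - g%:A)) * y = (1 - f *: x) * (1 - g *: y).
    rewrite mulrA -mulrA mulrBr mulrV // [_ * y]mulrBl mulVr //.
    by rewrite -scalerAr mulr1 -scalerAl mul1r.
  rewrite -[x * y](scalerK (mulf_neq0 f0 g0)) -scalerBr; congr (_ *: _).
  rewrite -[RHS](subKr ((f * g) *: (x * y))); congr (_ - _).
  rewrite mulrBl mul1r mulrBr mulr1 -scalerAl -scalerAr scalerA.
  by rewrite !opprB [LHS]addrC -addrA; congr (_ + _); rewrite opprD addrCA.
rewrite E // scalerA.
have -> : g / s * (f * g)^-1 = (s * f)^-1 by field; rewrite ?s0 ?f0 ?g0.
have -> : f *: X + g *: Y - 1 = (f + g - 1)%:A - (s * f) *: (a + b).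
  rewrite /X /Y !scalerBr !scalerA (mulrC f) (mulrC g) -sf.
  by rewrite scalerBl scalerDl scale1r scalerDr addrACA -opprD [LHS]addrAC.
by rewrite scalerBr !scalerA mulVf // scale1r mulrC opprD addrA.
Qed.

End Resolvents.

(** * From the invertibility of [1 - x y] to the spectrum of [a + b] *)

Theorem proposition4p3 (R : realType) (H : hilbertType R)
    (A : set 'B(H)) (phi : 'B(H) -> R[i]) (a b : 'B(H)) (s t : R[i]) :
  von_neumann_algebra A ->
  faithful_normal_tracial_state A phi ->
  A a -> A b -> star_free phi a b ->
  ((Normc.normc s)%:E < (spectral_radius A a)^-1)%E ->
  ((Normc.normc t)%:E < (spectral_radius A b)^-1)%E ->
  let f (z : R[i]) := phi (1 - z *: a)^-1 in
  let g (z : R[i]) := phi (1 - z *: b)^-1 in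
  let a0 (z : R[i]) := (1 - z *: a)^-1 - (f z)%:A in
  let b0 (z : R[i]) := (1 - z *: b)^-1 - (g z)%:A in
  s * f s = t * g t -> s * f s != 0 ->
  let lambda := (f s + g t - 1) / (s * f s) in
  [/\ lambda = s^-1 + t^-1 - (s * f s)^-1,
      lambda%:A - a - b =
        (g t / s) *: ((1 - s *: a)
                      * (1 - (f s * g t)^-1 *: (a0 s * b0 t))
                      * (1 - t *: b)),
      norm2 phi (a0 s) ^+ 2 * norm2 phi (b0 t) ^+ 2
        < `|f s| ^+ 2 * `|g t| ^+ 2 ->
      ~ spectrum A (a + b) lambda
    & norm2 phi (a0 s) ^+ 2 * norm2 phi (b0 t) ^+ 2
        = `|f s| ^+ 2 * `|g t| ^+ 2 ->
      spectrum A (a + b) lambda].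
Proof.
move=> AV phiS Aa Ab fr sa tb f g a0 b0 sf sf0 lambda.
have AS := vn_star_subalgebra AV.
have [s0 fs0] : s != 0 /\ f s != 0 by move: sf0; rewrite mulf_eq0 negb_or => /andP[].
have [t0 gt0] : t != 0 /\ g t != 0 by move: sf0; rewrite sf mulf_eq0 negb_or => /andP[].
have XU := resolvent_unit AS Aa s0 sa; have YU := resolvent_unit AS Ab t0 tb.
have E := resolvent_factorization XU YU sf sf0.
have GaS := vn_generated_star AV Aa; have GbS := vn_generated_star AV Ab.
have GaA := vn_generated_sub AV Aa; have GbA := vn_generated_sub AV Ab.
(* The resolvents stay in the generated algebras, so [a0 s] and [b0 t] are centered elements of free
   factors. *)
have resolvent_mem x z : A x -> 1 - z *: x \is a GRing.unit ->
    vn_generated x (1 - z *: x)^-1.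
  move=> Ax U; have GS := vn_generated_star AV Ax; apply: (star_inv GS) => //.
  apply: (op_subalgB GS); first exact: (op_subalg1 GS).
  exact: (op_subalgZ GS _ (@vn_generated_mem R H x)).
pose cent := @centered R H phi (vn_generated a) (vn_generated b).
have ca0 : cent true (a0 s).
  exact: (centered_part AV phiS GaS GbS GaA GbA (i := true) (resolvent_mem _ _ Aa XU)).
have cb0 : cent false (b0 t).
  exact: (centered_part AV phiS GaS GbS GaA GbA (i := false) (resolvent_mem _ _ Ab YU)).
have Aa0 : A (a0 s) by apply: GaA; case: ca0.
have Ab0 : A (b0 t) by apply: GbA; case: cb0.
(* The scalar is absorbed into the left factor, so that the product of 2-norms compares with 1. *)
pose c := (f s * g t)^-1.
have cx : cent true (c *: a0 s).
  have [Ga a00] := ca0; split; first exact: (op_subalgZ GaS).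
  by rewrite (stateZ AV phiS) // a00 mulr0.
pose nu := snorm (state_form phi).
pose K := normc (f s) * normc (g t).
have K0 : 0 < K by rewrite mulr_gt0 ?normc_gt0.
have nc : nu (c *: a0 s) * nu (b0 t) = nu (a0 s) * nu (b0 t) / K.
  rewrite /nu (snormZ (state_semi_inner AV phiS)) // /c Normc.normcV Normc.normcM.
  by rewrite -/K; field; rewrite gt_eqF.
have normE : norm2 phi (a0 s) ^+ 2 * norm2 phi (b0 t) ^+ 2 = ((nu (a0 s) * nu (b0 t)) ^+ 2)%:C.
  by rewrite !(norm2E AV phiS) // -rmorphM exprMn.
have KE : `|f s| ^+ 2 * `|g t| ^+ 2 = (K ^+ 2)%:C.
  by rewrite !normrC -!rmorphXn -rmorphM exprMn.
have n0 : 0 <= nu (a0 s) * nu (b0 t) by rewrite mulr_ge0 ?snorm_ge0.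
have WE : 1 - c *: (a0 s * b0 t) = 1 - (c *: a0 s) * b0 t by rewrite scalerAl.
have k0 : g t / s != 0 by rewrite mulf_neq0 // invr_eq0.
have spE : lambda%:A - (a + b) =
    (g t / s) *: ((1 - s *: a) * (1 - (c *: a0 s) * b0 t) * (1 - t *: b)).
  by rewrite -WE opprD addrA E.
have Aab : A (a + b) by apply: (op_subalgD AS).
rewrite normE KE; split=> //.
- have -> : s^-1 = (s * f s)^-1 * f s by rewrite invfM mulfVK.
  have -> : t^-1 = (s * f s)^-1 * g t by rewrite sf invfM mulfVK.
  by rewrite /lambda; ring.
- rewrite ltcR ltr_pXn2r ?nnegrE ?(ltW K0) // => lt1.
  apply/(not_spectrumP _ AS Aab); rewrite spE; apply: unitr_scale => //.
  rewrite (unitrMl _ YU) (unitrMr _ XU).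
  apply: (free_product_unit AV phiS GaS GbS GaA GbA fr (i := true)) => //.
  by rewrite -/nu nc ltr_pdivrMr // mul1r.
- move=> /complexI/eqP; rewrite eqrXn2 ?(ltW K0) // => /eqP eq1.
  apply: contrapT => /(not_spectrumP _ AS Aab); rewrite spE => U.
  have /negP : 1 - (c *: a0 s) * b0 t \isn't a GRing.unit.
    apply: (free_product_not_unit AV phiS GaS GbS GaA GbA fr (i := true)) => //.
    by rewrite -/nu nc eq1 divff // gt_eqF.
  apply; set W := 1 - c *: a0 s * b0 t in U *.
  (* Undoing the outer factors exhibits [W] as a product of units, which contradicts the case of
     norm product 1. *)
  have -> : W = (1 - s *: a)^-1 *
      ((g t / s)^-1 *: ((g t / s) *: ((1 - s *: a) * W * (1 - t *: b)))) * (1 - t *: b)^-1.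
    by rewrite scalerK // -!mulrA mulrV // mulr1 mulKr.
  by rewrite unitrMl ?unitrV // unitrMr ?unitrV //; apply: unitr_scale => //; rewrite invr_eq0.
Qed.
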